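(* Let $n\ge 4$ and let $q(x)\in\mathbb{C}[x]$ be a polynomial of degree $n$. Then the filtered algebra $D(q)$ is a deformation of the coordinate algebra of a Kleinian singularity of type $D_n$.
   Context: All algebras are over $\mathbb{C}$. For $n\ge 4$, the coordinate algebra of a Kleinian singularity of type $D_n$ is $\mathbb{C}[u,v,w]/((-1)^n u^{n-1}-uv^2+w^2)$, graded by putting $u,v,w$ in degrees $4$, $2n-4$, $2n-2$. A deformation of it is an (associative, unital) filtered algebra $F_0\subseteq F_1\subseteq\cdots$ (exhaustive) whose associated graded algebra is isomorphic, as a graded algebra, to this coordinate algebra. Definition of $D(q)$: let $q(x)\in\mathbb{C}[x]$ have degree $n\ge 4$. Put $\rho:=2q(-\tfrac12)$ and $s(x):=\dfrac{q(x)q(-x-1)}{x(x+1)(1+2x)^2}$. Let $G=\langle a\rangle$ be infinite cyclic and $\mathbb{C}(h)$ the field of rational functions in an indeterminate $h$. Let $\tilde T(s)$ be the skew group algebra $G\ast\mathbb{C}(h)$, i.e. the vector space $\mathbb{C}G\otimes\mathbb{C}(h)$ with multiplication $(a^i\, f(h))(a^j\, g(h))=a^{i+j}f(h+j)g(h)$, and put $b:=s(h)a^{-1}$. Then $D(q)$ is the subalgebra of $\tilde T(s)$ generated by $$u:=h^2,\qquad v:=a+b+\frac{2\rho}{1-4h^2},\qquad w:=(a-b)h-\frac{\rho}{1-4h^2}.$$ $D(q)$ is regarded as a filtered algebra by putting the generators $u,v,w$ in degrees $4$, $2n-4$, $2n-2$ respectively (so $F_m$ is the span of all words in $u,v,w$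 of total degree at most $m$). *)

(* Defs.v *)
From HB Require Import structures.
From mathcomp Require Import all_boot all_order all_algebra.
From mathcomp Require Import fraction generic_quotient ring_quotient.
From mathcomp Require Import finmap boolp.
From mathcomp Require Import mpoly.
From mathcomp Require monalg.

Set Implicit Arguments.
Unset Strict Implicit.
Unset Printing Implicit Defensive.

Import GRing.Theory.
Local Open Scope ring_scope.
Local Open Scope quotient_scope.

Record ideal2 (k : fieldType) (A : algType k) := Ideal2 {
  ideal2_pred :> {pred A};
  ideal2_zmod : zmod_closed ideal2_pred;
  ideal2_proper : 1 \notin ideal2_pred;
  ideal2_mull : forall a x, x \in ideal2_pred -> a * x \in ideal2_pred;
  ideal2_mulr : forall a x, x \in ideal2_pred -> x * a \in ideal2_pred }.

HB.instance Definition _ (k : fieldType) (A : algType k) (I : ideal2 A) :=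
  GRing.isZmodClosed.Build A (ideal2_pred I) (ideal2_zmod I).

Definition quotalg (k : fieldType) (A : algType k) (I : ideal2 A) : Type :=
  Quotient.quot (ideal2_pred I).

Section QuotAlg.
Variables (k : fieldType) (A : algType k) (I : ideal2 A).
Local Notation Q := (quotalg I).

HB.instance Definition _ := GRing.Zmodule.on Q.

Definition quotalg_pi (x : A) : Q := \pi_(Quotient.quot (ideal2_pred I)) x.
Definition quotalg_repr (x : Q) : A := repr (x : Quotient.quot (ideal2_pred I)).

Lemma quotalg_reprK : cancel quotalg_repr quotalg_pi.
Proof. by move=> x; rewrite /quotalg_pi /quotalg_repr reprK. Qed.

Lemma quotalg_piP x y : quotalg_pi x = quotalg_pi y <-> x - y \in ideal2_pred I.
Proof. by rewrite Quotient.idealrBE; split=> [/eqP|/eqP]. Qed.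

Lemma quotalg_piB : zmod_morphism quotalg_pi.
Proof. exact: pi_is_zmod_morphism. Qed.
HB.instance Definition _ :=
  GRing.isZmodMorphism.Build A Q quotalg_pi quotalg_piB.

Definition quotalg_one : Q := quotalg_pi 1.
Definition quotalg_mul (x y : Q) : Q :=
  quotalg_pi (quotalg_repr x * quotalg_repr y).
Definition quotalg_scale (c : k) (x : Q) : Q := quotalg_pi (c *: quotalg_repr x).

Lemma quotalg_repr_pi x : quotalg_repr (quotalg_pi x) - x \in ideal2_pred I.
Proof. by apply/quotalg_piP; rewrite quotalg_reprK. Qed.

Lemma quotalg_piM x y : quotalg_mul (quotalg_pi x) (quotalg_pi y) = quotalg_pi (x * y).
Proof.
apply/quotalg_piP; set x' := quotalg_repr _; set y' := quotalg_repr _.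
have -> : x' * y' - x * y = (x' - x) * y' + x * (y' - y).
  by rewrite mulrBl mulrBr addrA subrK.
by apply: rpredD; [apply: ideal2_mulr|apply: ideal2_mull]; apply: quotalg_repr_pi.
Qed.

Lemma quotalg_piZ c x : quotalg_scale c (quotalg_pi x) = quotalg_pi (c *: x).
Proof.
apply/quotalg_piP; rewrite -scalerBr -mulr_algl.
by apply: ideal2_mull; apply: quotalg_repr_pi.
Qed.

Lemma quotalg_ind (P : Q -> Prop) : (forall x, P (quotalg_pi x)) -> forall x, P x.
Proof. by move=> h x; rewrite -[x]quotalg_reprK. Qed.

Lemma quotalg_mulA : associative quotalg_mul.
Proof.
by elim/quotalg_ind=> x; elim/quotalg_ind=> y; elim/quotalg_ind=> z;
  rewrite !quotalg_piM mulrA.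
Qed.
Lemma quotalg_mul1 : left_id quotalg_one quotalg_mul.
Proof. by elim/quotalg_ind=> x; rewrite quotalg_piM mul1r. Qed.
Lemma quotalg_1mul : right_id quotalg_one quotalg_mul.
Proof. by elim/quotalg_ind=> x; rewrite quotalg_piM mulr1. Qed.
Lemma quotalg_mulDl : left_distributive quotalg_mul +%R.
Proof.
by elim/quotalg_ind=> x; elim/quotalg_ind=> y; elim/quotalg_ind=> z;
  rewrite -raddfD !quotalg_piM -raddfD mulrDl.
Qed.
Lemma quotalg_mulDr : right_distributive quotalg_mul +%R.
Proof.
by elim/quotalg_ind=> x; elim/quotalg_ind=> y; elim/quotalg_ind=> z;
  rewrite -raddfD !quotalg_piM -raddfD mulrDr.
Qed.
Lemma quotalg_one_neq0 : quotalg_one != 0.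
Proof.
rewrite -(raddf0 quotalg_pi); apply/eqP => /quotalg_piP.
by rewrite subr0; apply/negP/ideal2_proper.
Qed.

HB.instance Definition _ := GRing.Zmodule_isNzRing.Build Q
  quotalg_mulA quotalg_mul1 quotalg_1mul quotalg_mulDl quotalg_mulDr
  quotalg_one_neq0.

Lemma quotalg_scaleA a b x :
  quotalg_scale a (quotalg_scale b x) = quotalg_scale (a * b) x.
Proof. by elim/quotalg_ind: x => x; rewrite !quotalg_piZ scalerA. Qed.
Lemma quotalg_scale1 : left_id 1 quotalg_scale.
Proof. by elim/quotalg_ind=> x; rewrite quotalg_piZ scale1r. Qed.
Lemma quotalg_scaleDr : right_distributive quotalg_scale +%R.
Proof.
by move=> c; elim/quotalg_ind=> x; elim/quotalg_ind=> y;
  rewrite -raddfD !quotalg_piZ -raddfD scalerDr.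
Qed.
Lemma quotalg_scaleDl x : {morph quotalg_scale^~ x : a b / a + b}.
Proof.
by elim/quotalg_ind: x => x a b; rewrite !quotalg_piZ -raddfD scalerDl.
Qed.

HB.instance Definition _ := GRing.Zmodule_isLmodule.Build k Q
  quotalg_scaleA quotalg_scale1 quotalg_scaleDr quotalg_scaleDl.

Lemma quotalg_scaleAl c (x y : Q) : c *: (x * y) = (c *: x) * y.
Proof.
elim/quotalg_ind: x => x; elim/quotalg_ind: y => y.
change (quotalg_scale c (quotalg_mul (quotalg_pi x) (quotalg_pi y)) =
  quotalg_mul (quotalg_scale c (quotalg_pi x)) (quotalg_pi y)).
by rewrite quotalg_piM !quotalg_piZ quotalg_piM scalerAl.
Qed.
HB.instance Definition _ := GRing.Lmodule_isLalgebra.Build k Q quotalg_scaleAl.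

Lemma quotalg_scaleAr c (x y : Q) : c *: (x * y) = x * (c *: y).
Proof.
elim/quotalg_ind: x => x; elim/quotalg_ind: y => y.
change (quotalg_scale c (quotalg_mul (quotalg_pi x) (quotalg_pi y)) =
  quotalg_mul (quotalg_pi x) (quotalg_scale c (quotalg_pi y))).
by rewrite quotalg_piM !quotalg_piZ quotalg_piM scalerAr.
Qed.
HB.instance Definition _ := GRing.Lalgebra_isAlgebra.Build k Q quotalg_scaleAr.

Lemma quotalg_pi_monoid : monoid_morphism quotalg_pi.
Proof. by split=> // x y; rewrite -quotalg_piM. Qed.
HB.instance Definition _ :=
  GRing.isMonoidMorphism.Build A Q quotalg_pi quotalg_pi_monoid.
Lemma quotalg_pi_scalable : scalable quotalg_pi.
Proof. by move=> c x; rewrite -quotalg_piZ. Qed.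
HB.instance Definition _ :=
  GRing.isScalable.Build k A Q *:%R quotalg_pi quotalg_pi_scalable.

End QuotAlg.

Arguments quotalg_pi {k A} I x.

Record filtration (k : fieldType) (A : algType k) := Filtration {
  fil :> nat -> {pred A};
  fil_submod : forall m, submod_closed (fil m);
  fil_incr : forall m, {subset fil m <= fil m.+1};
  fil_one : 1 \in fil 0%N;
  fil_mul : forall i j x y, x \in fil i -> y \in fil j -> x * y \in fil (i + j)%N;
  fil_exhaustive : forall x, exists m, x \in fil m }.

Section AssociatedGraded.
Variables (k : fieldType) (A : algType k) (Fl : filtration A).

HB.instance Definition _ m :=
  GRing.isZmodClosed.Build A (fil Fl m) (GRing.submod_closedB (fil_submod Fl m)).

Lemma filZ m c x : x \in fil Fl m -> c *: x \in fil Fl m.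
Proof.
move=> xF; have [F0 FL] := fil_submod Fl m.
by rewrite -[c *: x]addr0; apply: FL.
Qed.

(* F_{m-1}, with F_{-1} = 0 *)
Definition fil_prev (m : nat) : {pred A} :=
  if m is m'.+1 then fil Fl m' else pred1 0.

Lemma fil_prev_zmod m : zmod_closed (fil_prev m).
Proof.
case: m => [|m] /=; last exact: (GRing.submod_closedB (fil_submod Fl m)).
by split=> [|x y]; rewrite !inE // => /eqP-> /eqP->; rewrite subr0.
Qed.
HB.instance Definition _ m :=
  GRing.isZmodClosed.Build A (fil_prev m) (fil_prev_zmod m).

Lemma fil_prevMl i j x y :
  x \in fil Fl i -> y \in fil_prev j -> x * y \in fil_prev (i + j)%N.
Proof.
case: j => [|j] xF /=; last by rewrite addnS; apply: fil_mul.
by rewrite inE => /eqP->; rewrite mulr0 rpred0.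
Qed.
Lemma fil_prevMr i j x y :
  x \in fil_prev i -> y \in fil Fl j -> x * y \in fil_prev (i + j)%N.
Proof.
case: i => [|i] xF yF; last by rewrite addSn; apply: fil_mul.
by move: xF; rewrite inE => /eqP->; rewrite mul0r rpred0.
Qed.

(* The graded algebra (+)_m F_m: an element is a finite sequence (x_m) with
   x_m \in F_m, encoded as the polynomial \sum_m x_m 'X^m with coefficients
   in A. *)
Definition rees_pred : {pred {poly A}} :=
  [pred p : {poly A} | `[< forall i, p`_i \in fil Fl i >]].

Lemma rees_predP (p : {poly A}) :
  reflect (forall i, p`_i \in fil Fl i) (p \in rees_pred).
Proof. exact: asboolP. Qed.

Lemma rees_subring : subring_closed rees_pred.
Proof.
split=> [|p q /rees_predP pF /rees_predP qF|p q /rees_predP pF /rees_predP qF];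
  apply/rees_predP => i.
- rewrite coef1; case: i => [|i] /=; first exact: fil_one.
  exact: rpred0.
- by rewrite coefB rpredB.
- rewrite coefM; apply: rpred_sum => j _.
  by have := fil_mul (pF j) (qF (i - j)%N); rewrite subnKC // -ltnS.
Qed.

Record rees := Rees { rees_val :> {poly A}; _ : rees_val \in rees_pred }.

HB.instance Definition _ := [isSub for rees_val].
HB.instance Definition _ := [Choice of rees by <:].
HB.instance Definition _ :=
  GRing.SubChoice_isSubNzRing.Build {poly A} rees_pred rees rees_subring.

Lemma rees_scale_subproof c (p : rees) : c%:A *: rees_val p \in rees_pred.
Proof.
apply/rees_predP => i; rewrite coefZ mulr_algl filZ //.
by case: p => p /= /rees_predP.
Qed.
Definition rees_scale (c : k) (p : rees) : rees := Rees (rees_scale_subproof c p).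

Lemma rees_scaleA a b p : rees_scale a (rees_scale b p) = rees_scale (a * b) p.
Proof. by apply: val_inj; rewrite /= scalerA -scalerAl mul1r scalerA. Qed.
Lemma rees_scale1 : left_id 1 rees_scale.
Proof. by move=> p; apply: val_inj; rewrite /= !scale1r. Qed.
Lemma rees_scaleDr : right_distributive rees_scale +%R.
Proof. by move=> c p q; apply: val_inj; rewrite /= scalerDr. Qed.
Lemma rees_scaleDl p : {morph rees_scale^~ p : a b / a + b}.
Proof. by move=> a b; apply: val_inj; rewrite /= !scalerDl. Qed.
HB.instance Definition _ := GRing.Zmodule_isLmodule.Build k rees
  rees_scaleA rees_scale1 rees_scaleDr rees_scaleDl.

Lemma rees_scaleAl c (p q : rees) : c *: (p * q) = (c *: p) * q.
Proof. by apply: val_inj; rewrite /= scalerAl. Qed.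
HB.instance Definition _ := GRing.Lmodule_isLalgebra.Build k rees rees_scaleAl.
Lemma rees_scaleAr c (p q : rees) : c *: (p * q) = p * (c *: q).
Proof.
apply: val_inj => /=; apply/polyP => i; rewrite coefZ !coefM mulr_algl.
rewrite scaler_sumr; apply: eq_bigr => j _.
by rewrite coefZ mulr_algl scalerAr.
Qed.
HB.instance Definition _ := GRing.Lalgebra_isAlgebra.Build k rees rees_scaleAr.

(* The ideal (+)_m F_{m-1} of (+)_m F_m. *)
Definition gr_ideal_pred : {pred rees} :=
  [pred p : rees | `[< forall i, (rees_val p)`_i \in fil_prev i >]].

Lemma gr_ideal_predP (p : rees) :
  reflect (forall i, (rees_val p)`_i \in fil_prev i) (p \in gr_ideal_pred).
Proof. exact: asboolP. Qed.

Lemma rees_coef (p : rees) i : (rees_val p)`_i \in fil Fl i.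
Proof. by case: p => p /= /rees_predP. Qed.

Lemma gr_ideal_zmod : zmod_closed gr_ideal_pred.
Proof.
split=> [|p q /gr_ideal_predP pI /gr_ideal_predP qI]; apply/gr_ideal_predP => i.
  by rewrite /= coef0 rpred0.
by rewrite /= coefB rpredB.
Qed.
Lemma gr_ideal_proper : 1 \notin gr_ideal_pred.
Proof.
apply/negP => /gr_ideal_predP /(_ 0%N) /=.
by rewrite coef1 inE oner_eq0.
Qed.
Lemma gr_ideal_mull a p : p \in gr_ideal_pred -> a * p \in gr_ideal_pred.
Proof.
move=> /gr_ideal_predP pI; apply/gr_ideal_predP => i /=.
rewrite coefM; apply: rpred_sum => j _.
by have := fil_prevMl (rees_coef a j) (pI (i - j)%N); rewrite subnKC // -ltnS.
Qed.
Lemma gr_ideal_mulr a p : p \in gr_ideal_pred -> p * a \in gr_ideal_pred.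
Proof.
move=> /gr_ideal_predP pI; apply/gr_ideal_predP => i /=.
rewrite coefM; apply: rpred_sum => j _.
by have := fil_prevMr (pI j) (rees_coef a (i - j)%N); rewrite subnKC // -ltnS.
Qed.

Definition gr_ideal : ideal2 rees :=
  Ideal2 gr_ideal_zmod gr_ideal_proper gr_ideal_mull gr_ideal_mulr.

(* gr A = (+)_m F_m / F_{m-1}, as the quotient of (+)_m F_m by (+)_m F_{m-1};
   (x + F_{i-1}) (y + F_{j-1}) = x y + F_{i+j-1} because
   (x 'X^i) (y 'X^j) = (x y) 'X^(i+j) in {poly A}. *)
Definition gr : algType k := quotalg gr_ideal.

Lemma rees_mono_subproof m (x : A) (xF : x \in fil Fl m) :
  x *: 'X^m \in rees_pred.
Proof.
apply/rees_predP => i; rewrite coefZ coefXn.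
by case: eqP => [->|_]; rewrite ?mulr1 // mulr0 rpred0.
Qed.

(* the class x + F_{m-1} in F_m / F_{m-1}, for x \in F_m *)
Definition gr_class m (x : A) (xF : x \in fil Fl m) : gr :=
  quotalg_pi gr_ideal (Rees (rees_mono_subproof xF)).

Definition gr_deg (m : nat) (z : gr) : Prop :=
  exists (x : A) (xF : x \in fil Fl m), z = gr_class xF.

End AssociatedGraded.

Definition graded_isom (k : fieldType) (A B : algType k)
    (degA : nat -> A -> Prop) (degB : nat -> B -> Prop) : Prop :=
  exists2 phi : {lrmorphism A -> B},
    bijective phi & forall m x, degA m x <-> degB m (phi x).

Definition is_deformation (k : fieldType) (A : algType k) (Fl : filtration A)
    (B : algType k) (degB : nat -> B -> Prop) : Prop :=
  graded_isom (@gr_deg k A Fl) degB.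

Section Generated.
Variables (k : fieldType) (A : algType k) (r : nat) (g : 'I_r -> A).

Definition gen_pred : {pred A} :=
  [pred x | `[< forall S : {pred A},
     subalg_closed S -> (forall i, g i \in S) -> x \in S >]].

Lemma gen_predP x :
  reflect (forall S : {pred A},
     subalg_closed S -> (forall i, g i \in S) -> x \in S) (x \in gen_pred).
Proof. exact: asboolP. Qed.

Lemma gen_subalg : subalg_closed gen_pred.
Proof.
split=> [|c x y /gen_predP xG /gen_predP yG|x y /gen_predP xG /gen_predP yG];
  apply/gen_predP => S Salg Sg; have [S1 SL SM] := Salg.
- exact: S1.
- by apply: SL; [apply: xG|apply: yG].
- by apply: SM; [apply: xG|apply: yG].
Qed.

Record gen_alg := GenAlg { gen_val :> A; _ : gen_val \in gen_pred }.

HB.instance Definition _ := [isSub for gen_val].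
HB.instance Definition _ := [Choice of gen_alg by <:].
HB.instance Definition _ :=
  GRing.SubChoice_isSubAlgebra.Build k A gen_pred gen_alg gen_subalg.

Lemma gen_subproof i : g i \in gen_pred.
Proof. by apply/gen_predP => S _; apply. Qed.
Definition gen (i : 'I_r) : gen_alg := GenAlg (gen_subproof i).

Definition word (w : seq 'I_r) : gen_alg := \prod_(i <- w) gen i.

Variable d : 'I_r -> nat.
Definition wdeg (w : seq 'I_r) : nat := (\sum_(i <- w) d i)%N.

Definition word_span (m : nat) (x : gen_alg) : Prop :=
  exists2 s : seq (k * seq 'I_r),
    all (fun cw => wdeg cw.2 <= m)%N s & x = \sum_(cw <- s) cw.1 *: word cw.2.

Definition word_fil (m : nat) : {pred gen_alg} := [pred x | `[< word_span m x >]].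

Lemma word_filP m x : reflect (word_span m x) (x \in word_fil m).
Proof. exact: asboolP. Qed.

Lemma word_fil_submod m : submod_closed (word_fil m).
Proof.
split=> [|c x y /word_filP[s sm ->] /word_filP[t tm ->]]; apply/word_filP.
  by exists [::]; rewrite ?big_nil.
exists ([seq (c * cw.1, cw.2) | cw <- s] ++ t).
  rewrite all_cat tm andbT all_map; exact: sm.
rewrite big_cat big_map /= scaler_sumr; congr (_ + _).
by apply: eq_bigr => cw _; rewrite scalerA.
Qed.

Lemma word_fil_le m m' : (m <= m')%N -> {subset word_fil m <= word_fil m'}.
Proof.
move=> le_m x /word_filP[s sm ->]; apply/word_filP; exists s => //.
by apply: sub_all sm => cw /leq_trans; apply.
Qed.

Lemma word_fil_word w : word w \in word_fil (wdeg w).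
Proof.
apply/word_filP; exists [:: (1, w)]; first by rewrite /= leqnn.
by rewrite big_seq1 scale1r.
Qed.

Lemma word_fil_sum m (I : eqType) (s : seq I) (F : I -> gen_alg) :
  {in s, forall i, F i \in word_fil m} -> \sum_(i <- s) F i \in word_fil m.
Proof.
have [F0 FL] := word_fil_submod m.
elim: s => [|i s IHs] sF; first by rewrite big_nil.
rewrite big_cons -[F i]scale1r; apply: FL; first by apply: sF; rewrite mem_head.
by apply: IHs => j js; apply: sF; rewrite inE js orbT.
Qed.

Lemma word_filZ m c x : x \in word_fil m -> c *: x \in word_fil m.
Proof.
have [F0 FL] := word_fil_submod m.
by move=> xF; rewrite -[c *: x]addr0; apply: FL.
Qed.

Lemma word_fil_mul i j x y :
  x \in word_fil i -> y \in word_fil j -> x * y \in word_fil (i + j)%N.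
Proof.
move=> /word_filP[s /allP si ->] /word_filP[t /allP tj ->].
rewrite mulr_suml; apply: word_fil_sum => cw cws.
rewrite mulr_sumr; apply: word_fil_sum => cw' cwt.
rewrite -scalerAl -scalerAr; do 2 apply: word_filZ.
rewrite /word -big_cat; apply: (word_fil_le _ (word_fil_word _)).
by rewrite /wdeg big_cat leq_add //; [apply: si|apply: tj].
Qed.

Lemma word_fil_one : 1 \in word_fil 0.
Proof.
have := word_fil_word [::]; rewrite /word big_nil /wdeg big_nil; exact.
Qed.

Lemma word_fil_exhaustive x : exists m, x \in word_fil m.
Proof.
pose S : {pred A} := [pred y | `[< exists2 z, val z = y &
  exists m, z \in word_fil m >]].
have SP y : reflect (exists2 z, val z = y & exists m, z \in word_fil m) (y \in S).
  exact: asboolP.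
have Salg : subalg_closed S.
  split.
  - by apply/SP; exists 1 => //; exists 0%N; apply: word_fil_one.
  - move=> c y y' /SP[z <- [m zm]] /SP[z' <- [m' zm']]; apply/SP.
    exists (c *: z + z') => //; exists (maxn m m').
    have [_ FL] := word_fil_submod (maxn m m').
    apply: FL; first exact: (word_fil_le (leq_maxl _ _) zm).
    exact: (word_fil_le (leq_maxr _ _) zm').
  - move=> y y' /SP[z <- [m zm]] /SP[z' <- [m' zm']]; apply/SP.
    by exists (z * z') => //; exists (m + m')%N; apply: word_fil_mul.
have Sg i : g i \in S.
  apply/SP; exists (gen i) => //; exists (wdeg [:: i]).
  by have := word_fil_word [:: i]; rewrite /word big_seq1.
have /gen_predP /(_ S Salg Sg) /SP[z /val_inj <- //] : val x \in gen_pred.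
by case: x.
Qed.

Definition word_filtration : filtration gen_alg :=
  Filtration word_fil_submod (fun m => word_fil_le (leqnSn m)) word_fil_one
    word_fil_mul word_fil_exhaustive.

End Generated.

(* Truncated subtraction: only meaningful for n >= 2. *)
Definition Dn_deg (n : nat) (i : 'I_3) : nat :=
  nth 0%N [:: 4; 2 * n - 4; 2 * n - 2]%N i.

Definition Dn_weight (n : nat) (m : 'X_{1..3}) : nat :=
  (\sum_i m i * Dn_deg n i)%N.

Lemma Dn_weight0 n : Dn_weight n 0%MM = 0%N.
Proof. by rewrite /Dn_weight big1 // => i _; rewrite mnm0E. Qed.
Lemma Dn_weightD n : {morph Dn_weight n : m1 m2 / (m1 + m2)%MM >-> (m1 + m2)%N}.
Proof.
move=> m1 m2; rewrite /Dn_weight -big_split; apply: eq_bigr => i _.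
by rewrite mnmDE mulnDl.
Qed.
HB.instance Definition _ n :=
  isMeasure.Build 3 (Dn_weight n) (Dn_weight0 n) (@Dn_weightD n).

Section Coordinate.
Variables (k : fieldType) (n : nat).

Definition Dn_eqn : {mpoly k[3]} :=
  let u := 'X_(@Ordinal 3 0 isT) in
  let v := 'X_(@Ordinal 3 1 isT) in
  let w := 'X_(@Ordinal 3 2 isT) in
  (-1) ^+ n * u ^+ n.-1 - u * v ^+ 2 + w ^+ 2.

Definition Dn_ideal_pred : {pred {mpoly k[3]}} :=
  [pred p : {mpoly k[3]} | `[< exists p', p = p' * Dn_eqn >]].

Lemma Dn_ideal_predP p :
  reflect (exists p', p = p' * Dn_eqn) (p \in Dn_ideal_pred).
Proof. exact: asboolP. Qed.

Lemma Dn_ideal_zmod : zmod_closed Dn_ideal_pred.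
Proof.
split=> [|p q /Dn_ideal_predP[p' ->] /Dn_ideal_predP[q' ->]]; apply/Dn_ideal_predP.
  by exists 0; rewrite mul0r.
by exists (p' - q'); rewrite mulrBl.
Qed.
Lemma Dn_ideal_proper : 1 \notin Dn_ideal_pred.
Proof.
apply/negP => /Dn_ideal_predP[p /(congr1 (meval
  (fun i : 'I_3 => nth 0 [:: 1; (~~ odd n)%:R; (odd n)%:R] i)))].
rewrite meval1 mevalM /Dn_eqn !(rmorphD, rmorphN, rmorphM, rmorphXn) /= !mevalXU /=.
rewrite rmorph1 -signr_odd expr1n; case: (odd n) => /= /eqP.
  by rewrite expr1 !(mulr1, mulr0, subr0) addNr mulr0 oner_eq0.
by rewrite expr0 !(mulr1, mulr0) subrr addr0 mulr0 oner_eq0.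
Qed.
Lemma Dn_ideal_mull a p : p \in Dn_ideal_pred -> a * p \in Dn_ideal_pred.
Proof.
by move=> /Dn_ideal_predP[p' ->]; apply/Dn_ideal_predP; exists (a * p'); rewrite mulrA.
Qed.
Lemma Dn_ideal_mulr a p : p \in Dn_ideal_pred -> p * a \in Dn_ideal_pred.
Proof. by rewrite mulrC; apply: Dn_ideal_mull. Qed.

Definition Dn_ideal : ideal2 {mpoly k[3]} :=
  Ideal2 Dn_ideal_zmod Dn_ideal_proper Dn_ideal_mull Dn_ideal_mulr.

Definition Dn_coord : algType k := quotalg Dn_ideal.

Definition Dn_coord_deg (m : nat) (z : Dn_coord) : Prop :=
  exists2 p : {mpoly k[3]},
    p \is m.-homog for (Dn_weight n) & z = quotalg_pi Dn_ideal p.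

End Coordinate.

Section Shift.
Variable k : fieldType.
Local Notation K := {fraction {poly k}}.
Local Notation "p %:F" := (@FracField.tofrac {poly k} p).
Implicit Types (f : K) (p : {poly k}).

Definition pshift (j : int) p : {poly k} := p \Po ('X + (j%:~R)%:P).

(* f(h) |-> f(h + j) on k(h) *)
Definition fshift (j : int) f : K :=
  (pshift j \n_(repr f))%:F / (pshift j \d_(repr f))%:F.

Lemma pshiftM j : {morph pshift j : p q / p * q}.
Proof. by move=> p q; rewrite /pshift comp_polyM. Qed.
Lemma pshiftD j : {morph pshift j : p q / p + q}.
Proof. by move=> p q; rewrite /pshift comp_polyD. Qed.
Lemma pshift_comp i j p : pshift i (pshift j p) = pshift (i + j) p.
Proof.
rewrite /pshift -comp_polyA comp_polyD comp_polyX comp_polyC rmorphD /=.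
by rewrite -addrA -polyCD.
Qed.
Lemma pshift0 p : pshift 0 p = p.
Proof. by rewrite /pshift addr0 comp_polyXr. Qed.
Lemma pshiftC j c : pshift j c%:P = c%:P.
Proof. by rewrite /pshift comp_polyC. Qed.
Lemma pshift_neq0 j p : p != 0 -> pshift j p != 0.
Proof.
apply: contraNneq => p0; rewrite -[p]pshift0 -(addNr j) -pshift_comp p0.
by rewrite /pshift comp_poly0.
Qed.

Lemma fraction_numden f : f = (\n_(repr f))%:F / (\d_(repr f))%:F.
Proof.
have dn0 : (\d_(repr f))%:F != 0 by rewrite tofrac_eq0 denom_ratioP.
apply: (canRL (mulfK dn0)).
suff piM (x : {ratio {poly k}}) :
    \pi_K x * (\d_x)%:F = (\n_x)%:F by rewrite -{1}[f]reprK piM.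
rewrite !piE; apply/eqmodP; rewrite /= /FracField.equivf /FracField.mulf.
by rewrite !numden_Ratio ?mulr1 ?oner_eq0 ?denom_ratioP // mulrC.
Qed.

Lemma fshiftE j p q : q != 0 ->
  fshift j (p%:F / q%:F) = (pshift j p)%:F / (pshift j q)%:F.
Proof.
move=> q0; rewrite /fshift; set f := p%:F / q%:F.
have d0 : \d_(repr f) != 0 := denom_ratioP _.
have := fraction_numden f; rewrite {1}/f => /eqP.
rewrite eqr_div ?tofrac_eq0 // -!tofracM tofrac_eq => /eqP e.
apply/eqP; rewrite eqr_div ?tofrac_eq0 ?pshift_neq0 // -!tofracM tofrac_eq.
by rewrite -!pshiftM e mulrC.
Qed.

Lemma fshift_tofrac j p : fshift j p%:F = (pshift j p)%:F.
Proof.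
have := @fshiftE j p 1 (oner_neq0 _).
by rewrite -[1]/(1%:P) pshiftC !tofrac1 !divr1.
Qed.

Lemma fractionP f : exists p q, q != 0 /\ f = p%:F / q%:F.
Proof.
by exists \n_(repr f), \d_(repr f); rewrite denom_ratioP -fraction_numden.
Qed.

Lemma fshift_zmod j : zmod_morphism (fshift j).
Proof.
move=> f f'; have [p [q [q0 ->]]] := fractionP f.
have [p' [q' [q0' ->]]] := fractionP f'.
have -> : p%:F / q%:F - p'%:F / q'%:F = (p * q' + (- p') * q)%:F / (q * q')%:F.
  rewrite -mulNr -tofracN addf_div ?tofrac_eq0 //.
  by rewrite -!tofracM -tofracD.
rewrite !fshiftE ?mulf_neq0 // pshiftD !pshiftM.
rewrite -mulNr -tofracN addf_div ?tofrac_eq0 ?pshift_neq0 //.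
rewrite -!tofracM -tofracD.
by rewrite {3}/pshift raddfN.
Qed.
HB.instance Definition _ j := GRing.isZmodMorphism.Build K K (fshift j) (fshift_zmod j).

Lemma fshift_monoid j : monoid_morphism (fshift j).
Proof.
split; first by rewrite -tofrac1 fshift_tofrac -[1]/(1%:P) pshiftC.
move=> f f'; have [p [q [q0 ->]]] := fractionP f.
have [p' [q' [q0' ->]]] := fractionP f'.
by rewrite mulf_div -!tofracM !fshiftE ?mulf_neq0 // !pshiftM mulf_div -!tofracM.
Qed.
HB.instance Definition _ j :=
  GRing.isMonoidMorphism.Build K K (fshift j) (fshift_monoid j).

Lemma fshift_comp i j f : fshift i (fshift j f) = fshift (i + j) f.
Proof.
have [p [q [q0 ->]]] := fractionP f.
by rewrite !fshiftE ?pshift_neq0 // !pshift_comp.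
Qed.
Lemma fshift0 f : fshift 0 f = f.
Proof.
have [p [q [q0 ->]]] := fractionP f.
by rewrite fshiftE // !pshift0.
Qed.
End Shift.

Module SkewAlgebra.
Import monalg.
Section Skew.
Variable k : fieldType.
Local Notation K := {fraction {poly k}}.
Local Notation "p %:F" := (@FracField.tofrac {poly k} p).
Local Open Scope fset_scope.
Local Open Scope ring_scope.

(* finitely supported families (f_i)_{i : int} of elements of k(h), standing
   for \sum_i a^i f_i(h) *)
Definition skew : Type := malg int K.

HB.instance Definition _ := GRing.Zmodule.on skew.
Implicit Types x y z : skew.

Definition skew_coef x (i : int) : K := mcoeff i x.

(* a^i f(h) *)
Definition skew_mono (i : int) (f : K) : skew := mkmalgU i f.

(* (a^i f(h)) (a^j g(h)) = a^(i+j) f(h+j) g(h), extended bilinearly *)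
Definition skew_mul x y : skew :=
  \sum_(i <- monalg.msupp x) \sum_(j <- monalg.msupp y)
    skew_mono (i + j) (fshift j (skew_coef x i) * skew_coef y j).

HB.instance Definition _ i :=
  GRing.Additive.copy (skew_mono i) (mkmalgU i : K -> malg int K).

Lemma skew_coef_out x i : i \notin monalg.msupp x -> skew_coef x i = 0.
Proof. exact: mcoeff_outdom. Qed.

Lemma skew_mulw (d1 d2 : {fset int}) x y :
  monalg.msupp x `<=` d1 -> monalg.msupp y `<=` d2 ->
  skew_mul x y = \sum_(i <- d1) \sum_(j <- d2)
    skew_mono (i + j) (fshift j (skew_coef x i) * skew_coef y j).
Proof.
move=> le1 le2; rewrite /skew_mul (big_fset_incl _ le1) /=.
  apply: eq_bigr => i _; apply: big_fset_incl => // j _ /skew_coef_out ->.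
  by rewrite mulr0 raddf0.
move=> i _ /skew_coef_out xi; rewrite big1 // => j _.
by rewrite xi rmorph0 mul0r raddf0.
Qed.

Lemma skew_mulDl : left_distributive skew_mul +%R.
Proof.
move=> x y z.
rewrite (@skew_mulw (monalg.msupp x `|` monalg.msupp y) (monalg.msupp z)) ?msuppD_le //.
rewrite (@skew_mulw (monalg.msupp x `|` monalg.msupp y) (monalg.msupp z) x) ?fsubsetUl //.
rewrite (@skew_mulw (monalg.msupp x `|` monalg.msupp y) (monalg.msupp z) y) ?fsubsetUr //.
rewrite -big_split; apply: eq_bigr => i _; rewrite -big_split; apply: eq_bigr => j _ /=.
by rewrite -raddfD -mulrDl -rmorphD /skew_coef mcoeffD.
Qed.
Lemma skew_mulDr : right_distributive skew_mul +%R.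
Proof.
move=> x y z.
rewrite (@skew_mulw (monalg.msupp x) (monalg.msupp y `|` monalg.msupp z)) ?msuppD_le //.
rewrite (@skew_mulw (monalg.msupp x) (monalg.msupp y `|` monalg.msupp z) x y) ?fsubsetUl //.
rewrite (@skew_mulw (monalg.msupp x) (monalg.msupp y `|` monalg.msupp z) x z) ?fsubsetUr //.
rewrite -big_split; apply: eq_bigr => i _; rewrite -big_split; apply: eq_bigr => j _ /=.
by rewrite -raddfD -mulrDr /skew_coef mcoeffD.
Qed.
Lemma skew_mul0l x : skew_mul 0 x = 0.
Proof. by rewrite /skew_mul monalg.msupp0 big_seq_fset0. Qed.
Lemma skew_mul0r x : skew_mul x 0 = 0.
Proof.
by rewrite /skew_mul monalg.msupp0 big1 // => i _; rewrite big_seq_fset0.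
Qed.

Lemma skew_monoM i j f f' :
  skew_mul (skew_mono i f) (skew_mono j f') = skew_mono (i + j) (fshift j f * f').
Proof.
rewrite (@skew_mulw [fset i] [fset j]) ?msuppU_le // !big_seq_fset1.
by rewrite /skew_coef !mcoeffUU.
Qed.

Lemma skewE x : x = \sum_(i <- monalg.msupp x) skew_mono i (skew_coef x i).
Proof. exact: monalgE. Qed.

Lemma skew_ind (P : skew -> Prop) :
  P 0 -> (forall x y, P x -> P y -> P (x + y)) ->
  (forall i f, P (skew_mono i f)) -> forall x, P x.
Proof. by move=> P0 PD PU x; rewrite [x]skewE; apply: big_ind. Qed.

Lemma skew_mulA : associative skew_mul.
Proof.
move=> x y z; elim/skew_ind: x => [|x x' IH IH'|i f].
- by rewrite !skew_mul0l.
- by rewrite !skew_mulDl IH IH'.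
elim/skew_ind: y => [|y y' IH IH'|j f'].
- by rewrite !(skew_mul0l, skew_mul0r).
- by rewrite !(skew_mulDl, skew_mulDr) IH IH'.
elim/skew_ind: z => [|z z' IH IH'|l f''].
- by rewrite !skew_mul0r.
- by rewrite !skew_mulDr IH IH'.
by rewrite !skew_monoM rmorphM /= fshift_comp addrA mulrA [l + j]addrC.
Qed.
Definition skew_one : skew := skew_mono 0 1.
Lemma skew_mul1 : left_id skew_one skew_mul.
Proof.
elim/skew_ind=> [|x y IH IH'|i f]; first by rewrite skew_mul0r.
  by rewrite skew_mulDr IH IH'.
by rewrite skew_monoM add0r rmorph1 mul1r.
Qed.
Lemma skew_1mul : right_id skew_one skew_mul.
Proof.
elim/skew_ind=> [|x y IH IH'|i f]; first by rewrite skew_mul0l.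
  by rewrite skew_mulDl IH IH'.
by rewrite skew_monoM addr0 fshift0 mulr1.
Qed.
Lemma skew_one_neq0 : skew_one != 0.
Proof.
by rewrite /skew_one /skew_mono monalgU_eq0 oner_eq0.
Qed.
HB.instance Definition _ := GRing.Zmodule_isNzRing.Build skew
  skew_mulA skew_mul1 skew_1mul skew_mulDl skew_mulDr skew_one_neq0.

Definition skew_scale (c : k) x : skew := skew_mono 0 (c%:P)%:F * x.

Lemma skew_mono_mul i j f f' :
  skew_mono i f * skew_mono j f' = skew_mono (i + j) (fshift j f * f').
Proof. exact: skew_monoM. Qed.

Lemma skew_constC (c : k) x :
  x * skew_mono 0 (c%:P)%:F = skew_mono 0 (c%:P)%:F * x.
Proof.
elim/skew_ind: x => [|x y IH IH'|i f]; first by rewrite mulr0 mul0r.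
  by rewrite mulrDl mulrDr IH IH'.
by rewrite !skew_mono_mul addr0 add0r fshift0 fshift_tofrac pshiftC mulrC.
Qed.

Lemma skew_scaleA a b x : skew_scale a (skew_scale b x) = skew_scale (a * b) x.
Proof.
by rewrite /skew_scale mulrA skew_mono_mul add0r fshift0 -tofracM -polyCM.
Qed.
Lemma skew_scale1 : left_id 1 skew_scale.
Proof. by move=> x; rewrite /skew_scale tofrac1; apply: mul1r. Qed.
Lemma skew_scaleDr : right_distributive skew_scale +%R.
Proof. by move=> c x y; rewrite /skew_scale mulrDr. Qed.
Lemma skew_scaleDl x : {morph skew_scale^~ x : a b / a + b}.
Proof. by move=> a b; rewrite /skew_scale polyCD tofracD raddfD mulrDl. Qed.
HB.instance Definition _ := GRing.Zmodule_isLmodule.Build k skew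
  skew_scaleA skew_scale1 skew_scaleDr skew_scaleDl.
Lemma skew_scaleAl c x y : c *: (x * y) = (c *: x) * y.
Proof. exact: mulrA. Qed.
HB.instance Definition _ := GRing.Lmodule_isLalgebra.Build k skew skew_scaleAl.
Lemma skew_scaleAr c x y : c *: (x * y) = x * (c *: y).
Proof.
rewrite -[LHS]/(skew_mono 0 _ * (x * y)) -[c *: y]/(skew_mono 0 _ * y).
by rewrite !mulrA skew_constC.
Qed.
HB.instance Definition _ := GRing.Lalgebra_isAlgebra.Build k skew skew_scaleAr.

End Skew.
End SkewAlgebra.
HB.export SkewAlgebra.

Section Dq.
Variables (k : fieldType) (q : {poly k}).
Local Notation K := {fraction {poly k}}.
Local Notation "p %:F" := (@FracField.tofrac {poly k} p).

Definition Dq_rho : k := 2 * q.[- 2^-1].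

Definition Dq_h : K := 'X%:F.

Definition Dq_s : K :=
  (q * (q \Po (- 'X - 1)))%:F
  / (Dq_h * (Dq_h + 1) * (1 + 2 * Dq_h) ^+ 2).

Definition Dq_a : skew k := skew_mono 1 1.
Definition Dq_b : skew k := skew_mono 0 Dq_s * skew_mono (-1) 1.

Definition Dq_u : skew k := skew_mono 0 (Dq_h ^+ 2).
Definition Dq_v : skew k :=
  Dq_a + Dq_b + skew_mono 0 (2 * (Dq_rho%:P)%:F / (1 - 4 * Dq_h ^+ 2)).
Definition Dq_w : skew k :=
  (Dq_a - Dq_b) * skew_mono 0 Dq_h
  - skew_mono 0 ((Dq_rho%:P)%:F / (1 - 4 * Dq_h ^+ 2)).

Definition Dq_gen (i : 'I_3) : skew k := nth 0 [:: Dq_u; Dq_v; Dq_w] i.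

Definition Dq : algType k := gen_alg Dq_gen.

(* n stands for the degree of q *)
Definition Dq_filtration (n : nat) : filtration Dq :=
  word_filtration Dq_gen (Dn_deg n).

End Dq.

(* Main.v *)
Require Import Defs.
From HB Require Import structures.
From mathcomp Require Import all_boot all_order all_algebra ssrAC.
From mathcomp Require Import complex reals.
From mathcomp Require Import boolp fraction mpoly ring zify.
From mathcomp Require monalg.

Set Implicit Arguments.
Unset Strict Implicit.
Unset Printing Implicit Defensive.

Import Order.TTheory GRing.Theory Num.Theory.

Local Open Scope ring_scope.

(** Two bounds on the associated graded algebra of D(q) meet.

    From above: put t = h + 1/2 and t' = h - 1/2.  The polynomial
    q(h) q(-h-1) is invariant under t -> -t, so it equals E(t^2) for some
    polynomial E, and E(0) = q(-1/2)^2 = rho^2/4.  Writing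
    E(x) = rho^2/4 + x E1(x), the numbers rho in the definitions of v and w
    are exactly what cancels the poles at h = 1/2 and h = -1/2, and a
    computation in the skew group algebra gives
      [u,v] = 2w + v,      [u,w] = 2vu + w + rho,
      [v,w] = - v^2 + (E1(t^2) - E1(t'^2)) / 2h,
      w^2 - vuv + vw + v^2 - rho v + (E1(t^2) + E1(t'^2)) / 2 = 0.
    The two expressions in E1 are polynomials in u = h^2, of degrees at most
    n-2 and exactly n-1, the second with leading coefficient (-1)^n c^2,
    where c is the leading coefficient of q.  Counting degrees, u, v, w
    commute modulo lower terms ([Dq_gen_commutator]), and their symbols
    satisfy (-1)^n c^2 u^(n-1) - u v^2 + w^2 = 0 ([Dq_relation_fil]).
    Dividing v and w by c turns this into the equation of D_n.

    From below: that equation rewrites w^2, so the monomials u^i v^j w^e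
    with e <= 1 span the quotient.  In the skew group algebra the element
    u^i v^j w^e has highest power of a equal to j + e, with coefficient a
    polynomial in h of degree 2i + e.  For e <= 1 the pair (j + e, 2i + e)
    determines (i, j, e), so these elements are linearly independent
    ([normal_monomials_free]); hence no relation is missing.

    [deformation_of_presentation] is the general principle that combines a
    presentation by commuting symbols with such a family of normal
    monomials. *)

(** * Symbols in the associated graded algebra *)

Section Classes.
Variables (k : fieldType) (A : algType k) (Fl : filtration A).

Lemma gr_class_eq0 m (x : A) (xF : x \in fil Fl m) :
  gr_class xF = 0 <-> x \in fil_prev Fl m.
Proof.
rewrite /gr_class -(raddf0 (quotalg_pi (gr_ideal Fl))) quotalg_piP subr0.
split=> [/gr_ideal_predP/(_ m)|xP].
  by rewrite /= coefZ coefXn eqxx mulr1.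
apply/gr_ideal_predP => i; rewrite /= coefZ coefXn.
by case: eqP => [->|_]; rewrite ?mulr1 // mulr0 rpred0.
Qed.

Lemma gr_class_irr m (x y : A) (xF : x \in fil Fl m) (yF : y \in fil Fl m) :
  x = y -> gr_class xF = gr_class yF.
Proof. by move=> exy; congr (quotalg_pi _ _); apply: val_inj; rewrite /= exy. Qed.

(** A relation, so that statements about classes in [gr] never mention the
    proofs that elements lie in the filtration. *)
Definition symbol m (x : A) (z : gr Fl) : Prop :=
  exists xF : x \in fil Fl m, z = gr_class xF.

Lemma symbol_inj m (x y : A) (z : gr Fl) :
  symbol m x z -> symbol m y z -> x - y \in fil_prev Fl m.
Proof.
case=> xF -> [yF] /quotalg_piP /gr_ideal_predP/(_ m).
by rewrite /= coefB !coefZ coefXn eqxx !mulr1.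
Qed.

Lemma symbol_prev m (x : A) : x \in fil_prev Fl m -> symbol m x 0.
Proof.
move=> xP; have xF : x \in fil Fl m.
  by case: m xP => [|m] /=; [rewrite inE => /eqP->; rewrite rpred0|apply: fil_incr].
by exists xF; apply/esym/gr_class_eq0.
Qed.

Lemma symbolD m x y z t :
  symbol m x z -> symbol m y t -> symbol m (x + y) (z + t).
Proof.
case=> xF -> [yF ->]; exists (rpredD xF yF).
by rewrite /gr_class -raddfD; congr (quotalg_pi _ _); apply: val_inj; rewrite /= scalerDl.
Qed.

Lemma symbolZ m c x z : symbol m x z -> symbol m (c *: x) (c *: z).
Proof.
case=> xF ->; exists (filZ c xF).
rewrite /gr_class -linearZ; congr (quotalg_pi _ _); apply: val_inj => /=.
by rewrite scalerA mulr_algl.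
Qed.

Lemma symbolM i j x y z t :
  symbol i x z -> symbol j y t -> symbol (i + j) (x * y) (z * t).
Proof.
case=> xF -> [yF ->]; exists (fil_mul xF yF).
rewrite /gr_class -rmorphM; congr (quotalg_pi _ _); apply: val_inj => /=.
by rewrite -scalerAl -commr_polyXn -scalerAl scalerA -exprD addnC.
Qed.

Lemma symbol1 : symbol 0 1 1.
Proof.
exists (fil_one Fl); rewrite /gr_class -(rmorph1 (quotalg_pi (gr_ideal Fl))).
by congr (quotalg_pi _ _); apply: val_inj; rewrite /= expr0 scale1r.
Qed.

Lemma symbolX i x z m : symbol i x z -> symbol (m * i) (x ^+ m) (z ^+ m).
Proof.
move=> xz; elim: m => [|m IH]; first exact: symbol1.
by rewrite !exprS mulSn; apply: symbolM.
Qed.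

Lemma symbol_sum m (I : eqType) (s : seq I) (F : I -> A) (G : I -> gr Fl) :
  {in s, forall i, symbol m (F i) (G i)} ->
  symbol m (\sum_(i <- s) F i) (\sum_(i <- s) G i).
Proof.
elim: s => [|i s IH] FG.
  by rewrite !big_nil; apply: symbol_prev; rewrite rpred0.
rewrite !big_cons; apply: symbolD; first by apply: FG; rewrite mem_head.
by apply: IH => j js; apply: FG; rewrite inE js orbT.
Qed.

Lemma symbol_prod (I : Type) (s : seq I) (d : I -> nat)
    (F : I -> A) (G : I -> gr Fl) :
  (forall i, symbol (d i) (F i) (G i)) ->
  symbol (\sum_(i <- s) d i) (\prod_(i <- s) F i) (\prod_(i <- s) G i).
Proof.
move=> FG; elim: s => [|i s IH]; first by rewrite !big_nil; apply: symbol1.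
by rewrite !big_cons; apply: symbolM.
Qed.

Lemma rees_val_sum (I : Type) (s : seq I) (F : I -> rees Fl) :
  rees_val (\sum_(i <- s) F i) = \sum_(i <- s) rees_val (F i).
Proof. exact: (big_morph (@rees_val _ _ Fl) (fun _ _ => erefl) erefl). Qed.

Lemma gr_sum_of_homogeneous (z : gr Fl) :
  exists N (zf : nat -> gr Fl),
    (forall i, gr_deg i (zf i)) /\ z = \sum_(i < N) zf i.
Proof.
elim/quotalg_ind: z => p; exists (size (rees_val p)).
exists (fun i => gr_class (rees_coef p i)); split.
  by move=> i; exists ((rees_val p)`_i), (rees_coef p i).
rewrite /gr_class -raddf_sum; congr (quotalg_pi _ _); apply: val_inj => /=.
by rewrite rees_val_sum /= -[LHS]coefK poly_def.
Qed.

(** The sum of the pieces F_i / F_(i-1) is direct because two elements of the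
    Rees algebra are congruent only if they are so coefficient by
    coefficient. *)
Lemma gr_homogeneous_independent N (zf : nat -> gr Fl) :
  (forall i, gr_deg i (zf i)) -> \sum_(i < N) zf i = 0 ->
  forall i, (i < N)%N -> zf i = 0.
Proof.
move=> zfd; have [x xz] := @boolp.choice _ _ (fun i y => symbol i y (zf i)) zfd.
have xF i : x i \in fil Fl i by case: (xz i).
have zE i : zf i = gr_class (xF i).
  by case: (xz i) => yF ->; rewrite (Prop_irrelevance yF (xF i)).
under eq_bigr do rewrite zE.
rewrite /gr_class -raddf_sum => sum0 i ltiN; rewrite zE; apply/gr_class_eq0.
move: sum0; rewrite -(raddf0 (quotalg_pi (gr_ideal Fl))) => /quotalg_piP.
rewrite subr0 => /gr_ideal_predP/(_ i); rewrite rees_val_sum /= coef_sum.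
rewrite (bigD1 (Ordinal ltiN)) //= big1 ?addr0.
  by rewrite coefZ coefXn eqxx mulr1.
move=> j; rewrite -val_eqE /= => ji.
by rewrite coefZ coefXn eq_sym (negbTE ji) mulr0.
Qed.

End Classes.

(** * Presenting the associated graded algebra of a generated algebra *)

Section Presentation.
Variables (k : fieldType) (A0 : algType k) (r : nat) (g : 'I_r -> A0).
(* The variable 'X_i stands for the multiple c_i g_i of the i-th generator, so
   that a relation between the generators can be brought to a prescribed form. *)
Variables (mf : measure r) (d : 'I_r -> nat) (c : 'I_r -> k).
Hypothesis mfU : forall i, mf U_(i)%MM = d i.
Hypothesis c0 : forall i, c i != 0.

Local Notation A := (gen_alg g).
Local Notation Fl := (word_filtration g d).

Hypothesis gC : forall i j,
  gen g i * gen g j - gen g j * gen g i \in fil_prev Fl (d i + d j).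

Lemma gen_fil i : gen g i \in fil Fl (d i).
Proof.
by have := word_fil_word g d [:: i]; rewrite /word big_seq1 /wdeg big_seq1.
Qed.

Definition gen_symbol i : gr Fl := gr_class (gen_fil i).

Lemma gen_symbolP i : symbol (d i) (gen g i) (gen_symbol i).
Proof. by exists (gen_fil i). Qed.

Lemma gen_symbolC i j :
  gen_symbol i * gen_symbol j = gen_symbol j * gen_symbol i.
Proof.
have sij := symbolM (gen_symbolP i) (gen_symbolP j).
have := symbolM (gen_symbolP j) (gen_symbolP i); rewrite addnC => sji.
have := symbol_prev (gC i j).
have := symbolD sij (symbolZ (-1) sji); rewrite !scaleN1r => -[xF e] [yF].
by rewrite (Prop_irrelevance yF xF) -e => /esym/eqP; rewrite subr_eq0 => /eqP.
Qed.

(** Words of degree below m die in F_m / F_(m-1), and the symbol of a word is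
    the product of the symbols of its letters. *)
Lemma symbol_words m x z : symbol m x z ->
  exists2 s : seq (k * seq 'I_r), all (fun cw => wdeg d cw.2 == m)%N s &
    z = \sum_(cw <- s) cw.1 *: \prod_(i <- cw.2) gen_symbol i.
Proof.
case=> xF ->; have /word_filP[s sm xE] := xF.
elim: s sm x xF xE => [|[a w] s IH] /= => [_|/andP[wm sm]] x xF xE.
  exists [::] => //; rewrite big_nil; apply/gr_class_eq0.
  by rewrite xE big_nil rpred0.
rewrite big_cons in xE; set y := \sum_(j <- s) _ in xE.
have yF : y \in fil Fl m by apply/word_filP; exists s.
have [s' s'm yE] := IH sm y yF erefl.
have yS : symbol m y (gr_class yF) by exists yF.
have wS : symbol (wdeg d w) (word g w) (\prod_(i <- w) gen_symbol i).
  exact: symbol_prod gen_symbolP.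
move: wm; rewrite leq_eqVlt => /orP[/eqP wm|wm].
  exists ((a, w) :: s'); first by rewrite /= wm eqxx.
  rewrite big_cons -yE /=; rewrite wm in wS.
  have [xF' ->] := symbolD (symbolZ a wS) yS.
  exact: gr_class_irr.
exists s' => //; rewrite -yE.
have : a *: word g w \in fil_prev Fl m.
  case: m wm {sm x xF xE y yF IH yE s'm yS} => // m wm.
  by apply: filZ; apply: (word_fil_le _ (word_fil_word g d w)).
move/symbol_prev => /symbolD/(_ yS); rewrite add0r => -[xF' ->].
exact: gr_class_irr.
Qed.

(** The symbols of the generators commute, and they generate. *)
Lemma gr_comm (z t : gr Fl) : z * t = t * z.
Proof.
have [N [zf [zd ->]]] := gr_sum_of_homogeneous z.
have [M [tf [td ->]]] := gr_sum_of_homogeneous t.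
apply: commr_sum => i _; apply/commr_sym/commr_sum => j _; apply/commr_sym.
have [x /symbol_words[s _ ->]] := td i.
have [y /symbol_words[s' _ ->]] := zd j.
apply: commr_sum => cw _; apply/commr_sym/commr_sum => cw' _; apply/commr_sym.
rewrite /GRing.comm -!(scalerAl, scalerAr) [X in X = _]scalerA [RHS]scalerA mulrC.
congr (_ *: _).
apply: commr_prod => u _; apply/commr_sym/commr_prod => v _; apply/commr_sym.
exact: gen_symbolC.
Qed.

(** Evaluation at the symbols of the c_i g_i; multiplicative since [gr] is
    commutative. *)
Definition gr_eval (p : {mpoly k[r]}) : gr Fl :=
  mmap (in_alg (gr Fl)) (fun i => c i *: gen_symbol i) p.

(** Evaluation at the c_i g_i in the filtered algebra, each monomial being read
    with its variables in increasing order; only linear. *)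
Definition ordered_eval (p : {mpoly k[r]}) : A :=
  mmap (in_alg A) (fun i => c i *: gen g i) p.

HB.instance Definition _ := GRing.Additive.copy ordered_eval
  (mmap (in_alg A) (fun i => c i *: gen g i)).
HB.instance Definition _ := GRing.Additive.copy gr_eval
  (mmap (in_alg (gr Fl)) (fun i => c i *: gen_symbol i)).

Lemma ordered_evalZ : scalable ordered_eval.
Proof. by move=> a p; rewrite /ordered_eval mmapZ /= mulr_algl. Qed.
HB.instance Definition _ := GRing.isScalable.Build _ _ _ _ ordered_eval ordered_evalZ.

Lemma gr_evalZ : scalable gr_eval.
Proof. by move=> a p; rewrite /gr_eval mmapZ /= mulr_algl. Qed.
HB.instance Definition _ := GRing.isScalable.Build _ _ _ _ gr_eval gr_evalZ.

Lemma gr_eval_monoid : monoid_morphism gr_eval.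
Proof.
have [evM ev1] := @commr_mmap_is_multiplicative _ _ _
  (fun i => c i *: gen_symbol i) (in_alg (gr Fl))
  (fun i z => gr_comm z _) (fun p u v => gr_comm _ _).
by split.
Qed.
HB.instance Definition _ := GRing.isMonoidMorphism.Build _ _ gr_eval gr_eval_monoid.

Lemma symbol_ordered_eval m p :
  p \is m.-homog for mf -> symbol m (ordered_eval p) (gr_eval p).
Proof.
move=> /dhomogP pm; rewrite /ordered_eval /gr_eval /mmap.
apply: symbol_sum => u /pm <-; rewrite /= !mulr_algl; apply: symbolZ.
rewrite mfE; apply: symbol_prod => i; rewrite mfU; apply: symbolX.
exact/symbolZ/gen_symbolP.
Qed.

Lemma gr_eval_surj m z : gr_deg m z ->
  exists2 p, p \is m.-homog for mf & z = gr_eval p.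
Proof.
case=> x /symbol_words[s sm ->].
exists (\sum_(cw <- s) cw.1 *: \prod_(i <- cw.2) ((c i)^-1 *: 'X_i)).
  rewrite big_seq; apply: rpred_sum => cw /(allP sm) /eqP <-.
  apply: dhomogZ; rewrite /wdeg; elim: cw.2 => [|i w IH].
    by rewrite !big_nil dhomog1.
  rewrite !big_cons; apply: dhomogM => //; apply: dhomogZ.
  by rewrite dhomogX mfU.
rewrite linear_sum; apply: eq_bigr => cw _; rewrite linearZ /=.
rewrite rmorph_prod; congr (_ *: _); apply: eq_bigr => i _ /=.
by rewrite linearZ /= [gr_eval 'X_i]mmapX mmap1U scalerA mulVf ?c0 // scale1r.
Qed.

Variable I : ideal2 {mpoly k[r]}.
Hypothesis I0 : forall p, p \in ideal2_pred I -> gr_eval p = 0.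

(* Normal monomials: they span modulo I, degree by degree, and are linearly
   independent already in the filtered algebra. *)
Variable normal : pred 'X_{1..r}.
Definition normal_poly (p : {mpoly k[r]}) := forall m, ~~ normal m -> p@_m = 0.
Hypothesis normal_form : forall m, exists p,
  [/\ p \is (mf m).-homog for mf, normal_poly p & 'X_[m] - p \in ideal2_pred I].
Hypothesis normal_free : forall p, normal_poly p -> ordered_eval p = 0 -> p = 0.

Lemma homogeneous_normal_form m p : p \is m.-homog for mf ->
  exists p', [/\ p' \is m.-homog for mf, normal_poly p' & p - p' \in ideal2_pred I].
Proof.
move=> /dhomogP pm; have [nf nfP] := boolp.choice normal_form.
exists (\sum_(u <- msupp p) p@_u *: nf u); split.
- rewrite big_seq; apply: rpred_sum => u /pm <-; apply: dhomogZ.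
  by case: (nfP u).
- move=> v Nv; rewrite raddf_sum big1 // => u _ /=; rewrite mcoeffZ.
  by case: (nfP u) => _ -> //; rewrite mulr0.
- rewrite {1}[p]mpolyE -sumrB; apply: rpred_sum => u _.
  rewrite -scalerBr -mul_mpolyC; apply: ideal2_mull.
  by case: (nfP u).
Qed.

Lemma normal_polyB p p' : normal_poly p -> normal_poly p' -> normal_poly (p - p').
Proof. by move=> Np Np' m Nm; rewrite mcoeffB Np // Np' // subr0. Qed.

(** The normal monomials of degree below m span F_(m-1): subtract from x a
    normal representative of its symbol and repeat one degree lower. *)
Lemma fil_prev_normal m x : x \in fil_prev Fl m ->
  exists p, [/\ normal_poly p, forall u, (m <= mf u)%N -> p@_u = 0 &
    x = ordered_eval p].
Proof.
elim: m x => [|m IH] x.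
  by rewrite inE => /eqP ->; exists 0; split=> [u _|u _|]; rewrite ?mcoeff0 ?raddf0.
move=> /= xF; have [p pm xE] := gr_eval_surj (ex_intro _ x (ex_intro _ xF erefl)).
have [p' [p'm Np' pp']] := homogeneous_normal_form pm.
have xp' : symbol m x (gr_eval p').
  exists xF; rewrite xE; apply/eqP; rewrite eq_sym -subr_eq0 -raddfB.
  exact/eqP/I0.
have [p'' [Np'' p''m x_p']] := IH _ (symbol_inj xp' (symbol_ordered_eval p'm)).
exists (p'' + p'); split.
- by move=> u Nu; rewrite mcoeffD Np' // Np'' // addr0.
- move=> u mu; rewrite mcoeffD p''m ?(ltnW mu) // add0r.
  by apply: (dhomog_nemf_coeff p'm); rewrite gtn_eqF.
- by rewrite raddfD /= -x_p' subrK.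
Qed.

(** Replace p by its normal form.  If a normal p of degree m has zero symbol,
    its evaluation lies in F_(m-1), hence is a combination of normal monomials
    of degree below m; by independence p equals that combination, so p = 0. *)
Lemma kernel_sub_ideal m p : p \is m.-homog for mf -> gr_eval p = 0 ->
  p \in ideal2_pred I.
Proof.
move=> pm p0; have [p' [p'm Np' pp']] := homogeneous_normal_form pm.
have p'0 : gr_eval p' = 0.
  by move: (I0 pp'); rewrite raddfB /= p0 sub0r => /eqP; rewrite oppr_eq0 => /eqP.
have := symbol_ordered_eval p'm.
rewrite p'0 => /symbol_inj/(_ (symbol_prev (rpred0 _))).
rewrite subr0 => /fil_prev_normal[p'' [Np'' p''m e]].
suff p'_0 : p' = 0 by rewrite -[p]subr0 -p'_0.
have /eqP : p' - p'' = 0.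
  by apply: normal_free; [exact: normal_polyB|rewrite raddfB /= e subrr].
rewrite subr_eq0 => /eqP p'p''; apply/mpolyP => u; rewrite mcoeff0.
have [mu|mu] := eqVneq (mf u) m; first by rewrite p'p'' p''m ?mu.
exact: dhomog_nemf_coeff p'm mu.
Qed.

Definition quot_gr_eval (z : quotalg I) : gr Fl := gr_eval (quotalg_repr z).

Lemma quot_gr_eval_pi p : quot_gr_eval (quotalg_pi I p) = gr_eval p.
Proof.
apply/eqP; rewrite -subr_eq0 -raddfB; apply/eqP/I0.
exact: quotalg_repr_pi.
Qed.

Lemma quot_gr_eval_zmod : zmod_morphism quot_gr_eval.
Proof.
elim/quotalg_ind=> p; elim/quotalg_ind=> p'.
by rewrite -raddfB !quot_gr_eval_pi raddfB.
Qed.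
HB.instance Definition _ := GRing.isZmodMorphism.Build _ _ _ quot_gr_eval_zmod.

Lemma quot_gr_eval_scalable : scalable quot_gr_eval.
Proof.
move=> a; elim/quotalg_ind=> p.
by rewrite -linearZ /= !quot_gr_eval_pi linearZ.
Qed.
HB.instance Definition _ := GRing.isScalable.Build _ _ _ _ _ quot_gr_eval_scalable.

Lemma quot_gr_eval_monoid : monoid_morphism quot_gr_eval.
Proof.
split; first by rewrite -(rmorph1 (quotalg_pi I)) quot_gr_eval_pi rmorph1.
elim/quotalg_ind=> p; elim/quotalg_ind=> p'.
by rewrite -rmorphM !quot_gr_eval_pi rmorphM.
Qed.
HB.instance Definition _ := GRing.isMonoidMorphism.Build _ _ _ quot_gr_eval_monoid.

Lemma quot_gr_eval_inj : injective quot_gr_eval.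
Proof.
apply: raddf_inj; elim/quotalg_ind=> p; rewrite [X in X = _ -> _]quot_gr_eval_pi.
rewrite {1}(pihomog_partitionE (leqnn (mmeasure mf p))) raddf_sum /= => p0.
have pI i : pihomog mf i p \in ideal2_pred I.
  case: (ltnP i (mmeasure mf p)) => [lti|lei].
    apply: (kernel_sub_ideal (pihomogP mf i p)).
    apply: (gr_homogeneous_independent
      (zf := fun i => gr_eval (pihomog mf i p)) _ p0 lti) => j.
    by exists (ordered_eval (pihomog mf j p)); apply/symbol_ordered_eval/pihomogP.
  rewrite pihomogE big_seq_cond big_pred0 ?rpred0 // => u.
  apply/negP => /andP[/(mmeasure_mnm_lt mf) ltu /eqP eu].
  by move: ltu; rewrite eu ltnNge lei.
rewrite -(raddf0 (quotalg_pi I)); apply/quotalg_piP; rewrite subr0.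
by rewrite (pihomog_partitionE (leqnn (mmeasure mf p))) rpred_sum.
Qed.

Lemma quot_gr_eval_surj z : exists t, quot_gr_eval t = z.
Proof.
have [N [zf [zd ->]]] := gr_sum_of_homogeneous z.
have P i : exists p, gr_eval p = zf i.
  by have [p _ ->] := gr_eval_surj (zd i); exists p.
have [p pE] := boolp.choice P.
exists (quotalg_pi I (\sum_(i < N) p i)); rewrite quot_gr_eval_pi raddf_sum.
by apply: eq_bigr.
Qed.

(** Evaluation at symbols induces an isomorphism from the quotient by I: it is
    onto by [gr_eval_surj], and its kernel is generated by homogeneous
    elements, which lie in I by [kernel_sub_ideal]. *)
Theorem deformation_of_presentation :
  is_deformation Fl (fun m (z : quotalg I) =>
    exists2 p, p \is m.-homog for mf & z = quotalg_pi I p).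
Proof.
have [phi phiK] := boolp.choice quot_gr_eval_surj.
have Kphi : cancel quot_gr_eval phi by move=> z; apply: quot_gr_eval_inj; rewrite phiK.
have phi_zmod : zmod_morphism phi := can2_zmod_morphism Kphi phiK.
have phi_monoid : monoid_morphism phi := can2_monoid_morphism Kphi phiK.
have phi_scal : scalable phi := can2_scalable Kphi phiK.
pose phiM : {lrmorphism gr Fl -> quotalg I} := HB.pack phi
  (GRing.isZmodMorphism.Build _ _ phi phi_zmod)
  (GRing.isMonoidMorphism.Build _ _ phi phi_monoid)
  (GRing.isScalable.Build _ _ _ _ phi phi_scal).
exists phiM; first by exists quot_gr_eval.
move=> m z; split=> [/gr_eval_surj[p pm ->]|[p pm]].
  by exists p => //; rewrite -quot_gr_eval_pi /= Kphi.
move=> /(congr1 quot_gr_eval); rewrite /= phiK quot_gr_eval_pi => ->.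
by exists (ordered_eval p); apply: symbol_ordered_eval.
Qed.

End Presentation.

(** * Polynomials symmetric under reflection *)

Section Parity.
Variable k : fieldType.
Hypothesis two : (2 : k) != 0.
Implicit Types p : {poly k}.

Lemma even_odd_reflect p :
  p \Po (- 'X) = even_poly p \Po 'X^2 - (odd_poly p \Po 'X^2) * 'X.
Proof.
have e (s : {poly k}) : (s \Po 'X^2) \Po (- 'X) = s \Po 'X^2.
  by rewrite -comp_polyA comp_Xn_poly sqrrN.
by rewrite -{1}[p]poly_even_odd comp_polyD comp_polyM !e comp_polyX mulrN.
Qed.

Let two_poly : (2 : {poly k}) != 0.
Proof. by rewrite -polyC_natr polyC_eq0. Qed.

Lemma even_polyP p : p \Po (- 'X) = p -> even_poly p \Po 'X^2 = p.
Proof.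
rewrite even_odd_reflect -[in RHS](poly_even_odd p) => /addrI /esym/eqP.
rewrite -addr_eq0 -mulr2n -mulr_natl mulf_eq0 (negbTE two_poly) /= => /eqP e.
by rewrite -[RHS]poly_even_odd e addr0.
Qed.

Lemma odd_polyP p : p \Po (- 'X) = - p -> (odd_poly p \Po 'X^2) * 'X = p.
Proof.
rewrite even_odd_reflect -[in RHS](poly_even_odd p) opprD => /addIr /eqP.
rewrite -addr_eq0 -mulr2n -mulr_natl mulf_eq0 (negbTE two_poly) /= => /eqP e.
by rewrite -[RHS]poly_even_odd e add0r.
Qed.

Let X_half (c : k) : {poly k} := 'X + c%:P.

Lemma comp_X_half (c d : k) : X_half c \Po X_half d = X_half (c + d).
Proof.
by rewrite /X_half comp_polyD comp_polyX comp_polyC -addrA -polyCD [d + c]addrC.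
Qed.

Let halves : - 2^-1 + 2^-1 = 0 :> k. Proof. by rewrite addNr. Qed.

Lemma size_X_half c : size (X_half c) = 2.
Proof. exact: size_XaddC. Qed.

(** The substitution X -> X - 1/2 moves the centre of symmetry -1/2 of
    q(X) q(-X-1) to 0, where an even polynomial is a polynomial in X^2. *)
Lemma reflected_product (q : {poly k}) :
  exists E : {poly k}, [/\ q * (q \Po (- 'X - 1)) = E \Po ('X + (2^-1)%:P) ^+ 2,
    E`_0 = q.[- 2^-1] ^+ 2 & forall n, size q = n.+1 ->
      size E = n.+1 /\ E`_n = (-1) ^+ n * lead_coef q ^+ 2].
Proof.
pose P := (q \Po X_half (- 2^-1)) * (q \Po (- 'X - (2^-1)%:P)).
have Pe : P \Po (- 'X) = P.
  rewrite /P comp_polyM -!comp_polyA mulrC !comp_polyD !comp_polyC !comp_polyX.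
  rewrite !raddfN /= comp_polyX opprK !comp_polyC.
  by rewrite /X_half polyCN.
have PE := even_polyP Pe.
exists (even_poly P); split.
- have -> : ('X + (2^-1)%:P) ^+ 2 = 'X^2 \Po X_half 2^-1 :> {poly k}.
    by rewrite comp_Xn_poly.
  rewrite comp_polyA PE /P comp_polyM -!comp_polyA comp_X_half halves /X_half addr0.
  rewrite comp_polyXr.
  congr (_ * (_ \Po _)); rewrite comp_polyD !raddfN /= comp_polyX comp_polyC opprD -addrA.
  rewrite -[1]polyC1 -!polyCN -polyCD; congr (_ + _%:P).
  by field.
- rewrite coef_even_poly /= -horner_coef0 /P hornerM !horner_comp.
  rewrite !(hornerD, hornerN, hornerX, hornerC) !add0r oppr0 add0r.
  by rewrite expr2.
move=> n qn.
have q0 : q != 0 by rewrite -size_poly_eq0 qn.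
have sN : size (- 'X - (2^-1)%:P : {poly k}) = 2.
  by rewrite -opprD size_polyN size_XaddC.
have szP : size P = (n.*2).+1.
  rewrite size_mul -?size_poly_eq0 ?size_comp_poly2 ?size_X_half //= qn //.
  by rewrite addSn addnS -addnn.
split; first by rewrite size_even_poly_eq szP /= ?odd_double // doubleK.
rewrite coef_even_poly -[n.*2]/((n.*2).+1.-1) -szP -/(lead_coef P) lead_coefM.
rewrite !lead_coef_comp ?size_X_half ?sN // qn /= /X_half lead_coefXaddC expr1n mulr1.
rewrite -opprD lead_coefN lead_coefXaddC.
by ring.
Qed.

Lemma size_comp_sqr (E : {poly k}) n c : size E = n.+1 ->
  size (E \Po (X_half c) ^+ 2) = (n.*2).+1 /\ (E \Po (X_half c) ^+ 2)`_n.*2 = E`_n.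
Proof.
move=> En; have s2 : size (X_half c ^+ 2) = 3.
  by rewrite /X_half -[c]opprK polyCN size_exp_XsubC.
have sz : size (E \Po (X_half c) ^+ 2) = (n.*2).+1.
  have := size_comp_poly E (X_half c ^+ 2); rewrite s2 En /=.
  have : size (E \Po X_half c ^+ 2) != 0.
    rewrite size_poly_eq0 comp_poly_eq0 ?s2 // -size_poly_eq0 En //.
  case: (size _) => [|m] //= _ ->; congr _.+1; lia.
split=> //.
rewrite -[n.*2]/((n.*2).+1.-1) -sz -/(lead_coef _) lead_coef_comp ?s2 //.
by rewrite lead_coef_exp lead_coefXaddC !expr1n mulr1 lead_coefE En.
Qed.

Let neg_sqr c : (X_half c) ^+ 2 \Po (- 'X) = (X_half (- c)) ^+ 2.
Proof.
by rewrite rmorphXn /= comp_polyD comp_polyX comp_polyC -sqrrN opprD opprK /X_half polyCN.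
Qed.

Let swapped (E : {poly k}) c :
  (E \Po (X_half c) ^+ 2) \Po (- 'X) = E \Po (X_half (- c)) ^+ 2.
Proof. by rewrite -comp_polyA neg_sqr. Qed.

(** The difference is odd in X, hence X times a polynomial in X^2; its degree is
    at most 2n - 1 because the leading terms cancel. *)
Lemma difference_quotient (E : {poly k}) n : size E = n.+1 ->
  exists2 G : {poly k}, (size G <= n)%N &
  (2 : {poly k}) * 'X * (G \Po 'X^2) =
  (E \Po ('X + (2^-1)%:P) ^+ 2) - (E \Po ('X - (2^-1)%:P) ^+ 2).
Proof.
move=> En; rewrite -polyCN -/(X_half _) -/(X_half _).
pose D := (E \Po X_half 2^-1 ^+ 2) - (E \Po X_half (- 2^-1) ^+ 2); rewrite -/D.
have DN : D \Po (- 'X) = - D.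
  by rewrite /D comp_polyD raddfN /= !swapped opprK opprB.
exists (2^-1 *: odd_poly D).
  apply: leq_trans (size_scale_leq _ _) _.
  apply: leq_trans (size_odd_poly _) _.
  have : (size D <= (n.*2).+1)%N.
    apply: leq_trans (size_polyD _ _) _.
    by rewrite size_polyN !(size_comp_sqr _ En).1 maxnn.
  by move=> /half_leq; rewrite /= uphalf_double.
rewrite -[RHS](odd_polyP DN) comp_polyZ -polyC_natr mulrAC -scalerAr mul_polyC.
by rewrite scalerA mulVf // scale1r.
Qed.

(** The sum is even in X, hence a polynomial in X^2; the leading terms add up. *)
Lemma symmetric_sum (E : {poly k}) n : size E = n.+1 ->
  exists H : {poly k}, [/\ size H = n.+1, H`_n = E`_n &
  (2 : {poly k}) * (H \Po 'X^2) =
  (E \Po ('X + (2^-1)%:P) ^+ 2) + (E \Po ('X - (2^-1)%:P) ^+ 2)].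
Proof.
move=> En; rewrite -polyCN -/(X_half _) -/(X_half _).
pose D := (E \Po X_half 2^-1 ^+ 2) + (E \Po X_half (- 2^-1) ^+ 2); rewrite -/D.
have DN : D \Po (- 'X) = D.
  by rewrite /D comp_polyD !swapped opprK addrC.
have Dn : D`_n.*2 = 2 * E`_n.
  by rewrite coefD !(size_comp_sqr _ En).2 mulr_natl mulr2n.
have En0 : E`_n != 0.
  by rewrite -[n]/(n.+1.-1) -En -/(lead_coef E) lead_coef_eq0 -size_poly_eq0 En.
have szD : size D = (n.*2).+1.
  apply/eqP; rewrite eqn_leq; apply/andP; split.
    apply: leq_trans (size_polyD _ _) _.
    by rewrite !(size_comp_sqr _ En).1 maxnn.
  rewrite ltnNge; apply/negP => /leq_sizeP/(_ _ (leqnn _))/eqP.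
  by rewrite Dn mulf_eq0 (negbTE two) (negbTE En0).
exists (2^-1 *: even_poly D); split.
- rewrite size_scale ?invr_eq0 // size_even_poly_eq szD /= ?odd_double //.
  by rewrite doubleK.
- by rewrite coefZ coef_even_poly Dn mulKf.
- rewrite comp_polyZ (even_polyP DN) -polyC_natr mul_polyC scalerA divff //.
  by rewrite scale1r.
Qed.

End Parity.

(** * Rational identities behind the relations *)

Section FieldIdentities.
(* X and X' stand for E1(t^2) and E1(t'^2). *)
Variables (L : fieldType) (h r X X' : L).
Hypotheses (two : (2 : L) != 0) (h0 : h != 0) (hp : h + 1 != 0) (hm : h - 1 != 0).
Hypotheses (p1 : 1 + 2 * h != 0) (m1 : 1 - 2 * h != 0).
Hypotheses (p3 : 3 + 2 * h != 0) (m3 : 3 - 2 * h != 0).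

(** The summand rho / (1 - 4 h^2) of v and w, at h = x. *)
Definition rho_term (x : L) := r / (1 - 4 * x ^+ 2).
(** The function s at h = x, where q(x) q(-x-1) is split as
    rho^2/4 + (x + 1/2)^2 Y. *)
Definition split_s (x Y : L) :=
  (r ^+ 2 / 4 + (x + 2^-1) ^+ 2 * Y) / (x * (x + 1) * (1 + 2 * x) ^+ 2).

Let den0 : 1 - 4 * h ^+ 2 = (1 - 2 * h) * (1 + 2 * h). Proof. by ring. Qed.
Let denp : 1 - 4 * (h + 1) ^+ 2 = - (1 + 2 * h) * (3 + 2 * h). Proof. by ring. Qed.
Let denm : 1 - 4 * (h - 1) ^+ 2 = - (1 - 2 * h) * (3 - 2 * h). Proof. by ring. Qed.
Let four : (4 : L) != 0.
Proof. by rewrite (_ : 4 = 2 * 2 :> L) ?mulf_neq0 //; ring. Qed.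

Let f0 : rho_term h = r / ((1 - 2 * h) * (1 + 2 * h)).
Proof. by rewrite /rho_term den0. Qed.
Let fp : rho_term (h + 1) = r / (- (1 + 2 * h) * (3 + 2 * h)).
Proof. by rewrite /rho_term denp. Qed.
Let fm : rho_term (h - 1) = r / (- (1 - 2 * h) * (3 - 2 * h)).
Proof. by rewrite /rho_term denm. Qed.
Let s0 : split_s h X =
  (r ^+ 2 / 4 + (h + 2^-1) ^+ 2 * X) / (h * (h + 1) * (1 + 2 * h) ^+ 2).
Proof. by []. Qed.
Let sm : split_s (h - 1) X' =
  (r ^+ 2 / 4 + (h - 2^-1) ^+ 2 * X') / ((h - 1) * h * (1 - 2 * h) ^+ 2).
Proof.
rewrite /split_s; congr (_ / _); last by ring.
by congr (_ + _ ^+ 2 * _); field.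
Qed.


Let nz := (oppr_eq0, m1, p1, m3, p3, h0, hp, hm, two, four).

Local Notation F := (rho_term h).
Local Notation Fp := (rho_term (h + 1)).
Local Notation Fm := (rho_term (h - 1)).
Local Notation S := (split_s h X).
Local Notation S' := (split_s (h - 1) X').

(* In the names below, coef1, coef0 and coefN1 refer to the power a, 1 or a^-1
   whose coefficients are compared in the relation for [u,w], [v,w] or w^2. *)

Lemma uw_coef0 : h ^+ 2 * - F - - F * h ^+ 2 = 2 * (2 * F * h ^+ 2) - F + r.
Proof. by rewrite f0; field; rewrite !nz. Qed.

Lemma vw_coef1 : 2 * Fp * h + 1 * - F - (- Fp * 1 + h * (2 * F)) =
 - (2 * Fp * 1 + 1 * (2 * F)) + 0.
Proof. by rewrite f0 fp; field; rewrite !nz. Qed.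

Lemma vw_coefN1 s : 2 * Fm * (- s * h) + s * - F - (- Fm * s + - s * h * (2 * F)) =
 - (2 * Fm * s + s * (2 * F)) + 0.
Proof. by rewrite f0 fm; field; rewrite !nz. Qed.

(** The only place, with [ww_coef0], where the poles of s and of the rho terms
    meet and cancel. *)
Lemma vw_coef0 :  1 * (- S' * h) + 2 * F * - F + S * h -
 ((h - 1) * S' + - F * (2 * F) + - S * (h + 1) * 1) =
 - (1 * S' + 2 * F * (2 * F) + S * 1) + (X - X') / (2 * h).
Proof. by rewrite f0 s0 sm; field; rewrite !nz. Qed.

Lemma ww_coef1 :
 - Fp * h + h * - F - (2 * Fp * ((h + 1) ^+ 2 * 1) + 1 * (h ^+ 2 * (2 * F))) +
 (2 * Fp * h + 1 * - F) + (2 * Fp * 1 + 1 * (2 * F)) - r * 1 + 0 = 0.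
Proof. by rewrite f0 fp; field; rewrite !nz. Qed.

Lemma ww_coefN1 s :
 - Fm * (- s * h) + - s * h * - F -
 (2 * Fm * ((h - 1) ^+ 2 * s) + s * (h ^+ 2 * (2 * F))) +
 (2 * Fm * (- s * h) + s * - F) + (2 * Fm * s + s * (2 * F)) -
 r * s + 0 = 0.
Proof. by rewrite f0 fm; field; rewrite !nz. Qed.

Lemma ww_coef0 :
 (h - 1) * (- S' * h) + - F * - F + - S * (h + 1) * h -
 (1 * ((h - 1) ^+ 2 * S') + 2 * F * (h ^+ 2 * (2 * F)) +
  S * ((h + 1) ^+ 2 * 1)) +
 (1 * (- S' * h) + 2 * F * - F + S * h) + (1 * S' + 2 * F * (2 * F) + S * 1) -
 r * (2 * F) + (X + X') / 2 = 0.
Proof. by rewrite f0 s0 sm; field; rewrite !nz. Qed.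

End FieldIdentities.

(** * The relations in the skew group algebra *)

Lemma four_neq0 (L : fieldType) : (2 : L) != 0 -> (4 : L) != 0.
Proof. by move=> two; rewrite (_ : 4 = 2 * 2 :> L) ?mulf_neq0 //; ring. Qed.

Lemma half_sq (L : fieldType) (x : L) :
  (2 : L) != 0 -> (x * 2^-1) ^+ 2 = x ^+ 2 / 4.
Proof. by move=> two; field; rewrite two four_neq0. Qed.

(** Locked, here and below: otherwise unification of sums unfolds these elements
    and tries to compare rational functions by computation. *)
HB.lock Definition skew3 (k : fieldType) (x y z : {fraction {poly k}}) :
    SkewAlgebra.skew k :=
  SkewAlgebra.skew_mono 1 x + SkewAlgebra.skew_mono 0 y
  + SkewAlgebra.skew_mono (-1) z.

Arguments skew3 {k} x y z.

HB.lock Definition skew5 (k : fieldType) (x2 x1 x0 y1 y2 : {fraction {poly k}}) :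
    SkewAlgebra.skew k :=
  SkewAlgebra.skew_mono 2 x2 + SkewAlgebra.skew_mono (-2) y2
  + skew3 x1 x0 y1.

Arguments skew5 {k} x2 x1 x0 y1 y2.

Section Skew.
Variable k : fieldType.
Local Notation K := {fraction {poly k}}.
Local Notation "p %:F" := (@FracField.tofrac {poly k} p).
Local Notation smono := (@SkewAlgebra.skew_mono k).

Lemma skew3M (x1 x0 xm y1 y0 ym : K) :
  skew3 x1 x0 xm * skew3 y1 y0 ym =
  skew5 (fshift 1 x1 * y1) (fshift 1 x0 * y1 + x1 * y0)
    (fshift (-1) x1 * ym + x0 * y0 + fshift 1 xm * y1)
    (fshift (-1) x0 * ym + xm * y0) (fshift (-1) xm * ym).
Proof.
rewrite skew5.unlock skew3.unlock !raddfD /= !(mulrDl, mulrDr).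
rewrite !SkewAlgebra.skew_mono_mul.
rewrite !fshift0 !(addr0, add0r).
by rewrite [LHS](AC (3*3*3) ((1*9)*((4*2)*(3*5*7)*(6*8)))).
Qed.

Lemma skew3Mr (x1 x0 xm c : K) :
  skew3 x1 x0 xm * smono 0 c = skew3 (x1 * c) (x0 * c) (xm * c).
Proof.
by rewrite skew3.unlock !mulrDl !SkewAlgebra.skew_mono_mul !fshift0 !addr0.
Qed.

Lemma skew3Ml (x1 x0 xm c : K) :
  smono 0 c * skew3 x1 x0 xm = skew3 (fshift 1 c * x1) (c * x0) (fshift (-1) c * xm).
Proof.
by rewrite skew3.unlock !mulrDr !SkewAlgebra.skew_mono_mul !fshift0 !add0r.
Qed.

Lemma skew3D (x1 x0 xm y1 y0 ym : K) :
  skew3 x1 x0 xm + skew3 y1 y0 ym = skew3 (x1 + y1) (x0 + y0) (xm + ym).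
Proof. by rewrite skew3.unlock !raddfD /= [LHS](AC (3*3) ((1*4)*(2*5)*(3*6))). Qed.

Lemma skew3N (x1 x0 xm : K) : - skew3 x1 x0 xm = skew3 (- x1) (- x0) (- xm).
Proof. by rewrite skew3.unlock !raddfN /= !opprD. Qed.

Lemma skew5D (x2 x1 x0 xm xn y2 y1 y0 ym yn : K) :
  skew5 x2 x1 x0 xm xn + skew5 y2 y1 y0 ym yn =
  skew5 (x2 + y2) (x1 + y1) (x0 + y0) (xm + ym) (xn + yn).
Proof.
rewrite skew5.unlock -skew3D !raddfD /=.
by rewrite [LHS](AC (3*3) ((1*4)*(2*5)*(3*6))).
Qed.

Lemma skew5N (x2 x1 x0 xm xn : K) :
  - skew5 x2 x1 x0 xm xn = skew5 (- x2) (- x1) (- x0) (- xm) (- xn).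
Proof. by rewrite skew5.unlock -skew3N !raddfN /= !opprD. Qed.

Lemma skew3_5 (x1 x0 xm : K) : skew3 x1 x0 xm = skew5 0 x1 x0 xm 0.
Proof. by rewrite skew5.unlock !raddf0 !add0r. Qed.

Lemma smono0_3 (c : K) : smono 0 c = skew3 0 c 0.
Proof. by rewrite skew3.unlock !raddf0 addr0 add0r. Qed.

Lemma Dq_v_skew3 (q : {poly k}) :
  Dq_v q = skew3 1 (2 * rho_term (Dq_rho q)%:P%:F (Dq_h k)) (fshift (-1) (Dq_s q)).
Proof.
rewrite /Dq_v /Dq_a /Dq_b SkewAlgebra.skew_mono_mul add0r mulr1 skew3.unlock addrAC.
by rewrite /rho_term mulrA.
Qed.

Lemma Dq_w_skew3 (q : {poly k}) :
  Dq_w q = skew3 (Dq_h k) (- rho_term (Dq_rho q)%:P%:F (Dq_h k))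
    (- fshift (-1) (Dq_s q) * Dq_h k).
Proof.
rewrite /Dq_w /Dq_a /Dq_b SkewAlgebra.skew_mono_mul add0r mulr1 skew3.unlock.
rewrite mulrBl !SkewAlgebra.skew_mono_mul !addr0 !fshift0 mul1r mulNr !raddfN /=.
exact: addrAC.
Qed.

Lemma scale_skew (c : k) (x : SkewAlgebra.skew k) : c *: x = smono 0 (c%:P)%:F * x.
Proof. by []. Qed.

Lemma skew3_eq (x1 x0 xm y1 y0 ym : K) : x1 = y1 -> x0 = y0 -> xm = ym ->
  skew3 x1 x0 xm = skew3 y1 y0 ym.
Proof. by move=> -> -> ->. Qed.

Lemma skew5_eq (x2 x1 x0 xm xn y2 y1 y0 ym yn : K) :
  x2 = y2 -> x1 = y1 -> x0 = y0 -> xm = ym -> xn = yn ->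
  skew5 x2 x1 x0 xm xn = skew5 y2 y1 y0 ym yn.
Proof. by move=> -> -> -> -> ->. Qed.

Lemma shift_nat j m : fshift j (m%:R : K) = m%:R.
Proof. exact: rmorph_nat. Qed.

Lemma shift_one j : fshift j (1 : K) = 1.
Proof. exact: rmorph1. Qed.

Lemma shift_M j (x y : K) : fshift j (x * y) = fshift j x * fshift j y.
Proof. exact: rmorphM. Qed.

Lemma shift_X j (x : K) m : fshift j (x ^+ m) = fshift j x ^+ m.
Proof. exact: rmorphXn. Qed.

Lemma shift_N j (x : K) : fshift j (- x) = - fshift j x.
Proof. exact: rmorphN. Qed.

Section RelationsOverAbstractH.
(* The relations are proved for variable h, X, X' in the rational function
   field, so that field normalisation never meets explicit fractions. *)
Variables (h r X X' : K).
Hypotheses (two : (2 : K) != 0) (h0 : h != 0) (hp : h + 1 != 0) (hm : h - 1 != 0).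
Hypotheses (p1 : 1 + 2 * h != 0) (m1 : 1 - 2 * h != 0).
Hypotheses (p3 : 3 + 2 * h != 0) (m3 : 3 - 2 * h != 0).
Local Notation S := (split_s r h X).
Local Notation S' := (split_s r (h - 1) X').
Local Notation F := (rho_term r h).
Hypotheses (shift_h : (fshift 1 h = h + 1) * (fshift (-1) h = h - 1)).
Hypotheses (shift_S : fshift 1 S' = S).
Hypotheses (shift_F : (fshift 1 F = rho_term r (h + 1)) *
  (fshift (-1) F = rho_term r (h - 1))).
Hypotheses (shift_r : forall j, fshift j r = r).

Let u := smono 0 (h ^+ 2).
Let v := skew3 1 (2 * F) S'.
Let w := skew3 h (- F) (- S' * h).
Let shiftE :=
  (shift_M, shift_X, shift_N, shift_nat, shift_one, shift_h, shift_F, shift_S, shift_r).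

Lemma skew3_uv : u * v - v * u = smono 0 2 * w + v.
Proof.
rewrite /u /v /w skew3Mr !skew3Ml skew3N !skew3D.
by apply: skew3_eq; rewrite ?shiftE; ring.
Qed.

Lemma skew3_uw : u * w - w * u = smono 0 2 * (v * u) + w + smono 0 r.
Proof.
rewrite /u /v /w !skew3Mr (smono0_3 r) !skew3Ml skew3N !skew3D.
by apply: skew3_eq; rewrite ?shiftE; [ring|exact (uw_coef0 r p1 m1)|ring].
Qed.

Lemma skew3_vw : v * w - w * v = - (v * v) + smono 0 ((X - X') / (2 * h)).
Proof.
rewrite /u /v /w !skew3M (smono0_3 (_ / _)) (skew3_5 _ (_ / _)) !skew5N !skew5D.
apply: skew5_eq; rewrite ?shiftE.
- ring.
- exact (vw_coef1 r p1 m1 p3).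
- exact (vw_coef0 r X X' two h0 hp hm p1 m1).
- exact (vw_coefN1 r p1 m1 m3 _).
- ring.
Qed.

(** The terms vw and v^2 are what makes the coefficients of a^2 and a^-2
    vanish, and rho v what makes those of a and a^-1 vanish. *)
Lemma skew3_ww :
  w * w - v * (u * v) + v * w + v * v - smono 0 r * v
  + smono 0 ((X + X') / 2) = 0.
Proof.
have zero : 0 = skew5 (0 : K) 0 0 0 0.
  by rewrite -(skew3_5 (0 : K) 0 0) -(smono0_3 (0 : K)) raddf0.
rewrite [RHS]zero.
rewrite /u /v /w !skew3Ml !skew3M (smono0_3 (_ / _)).
rewrite (skew3_5 _ (_ / _)) (skew3_5 (fshift 1 r * _)) !skew5N !skew5D.
apply: skew5_eq; rewrite ?shiftE.
- ring.
- exact (ww_coef1 r p1 m1 p3).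
- exact (ww_coef0 r X X' two h0 hp hm p1 m1).
- exact (ww_coefN1 r p1 m1 m3 _).
- ring.
Qed.
End RelationsOverAbstractH.

Lemma shiftC (c : k) j : fshift j (c%:P%:F) = c%:P%:F.
Proof. by rewrite fshift_tofrac pshiftC. Qed.

Lemma shift1h : fshift 1 (Dq_h k) = Dq_h k + 1.
Proof. by rewrite /Dq_h fshift_tofrac /pshift comp_polyX tofracD polyC1 tofrac1. Qed.

Lemma shiftm1h : fshift (-1) (Dq_h k) = Dq_h k - 1.
Proof.
rewrite /Dq_h fshift_tofrac /pshift comp_polyX tofracD polyCN tofracN.
by rewrite polyC1 tofrac1.
Qed.

Lemma tofrac_linear_neq0 (a b : k) : b != 0 -> a%:P%:F + b%:P%:F * Dq_h k != 0.
Proof.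
move=> b0; rewrite /Dq_h -tofracM -tofracD tofrac_eq0.
rewrite -size_poly_eq0 addrC mul_polyC size_polyDl.
  by rewrite size_scale // size_polyX.
by rewrite size_scale // size_polyX (leq_ltn_trans (size_polyC_leq1 _)).
Qed.

Lemma natF m : (m%:R : k)%:P%:F = m%:R.
Proof. by rewrite !rmorph_nat. Qed.

Hypothesis two : (2 : k) != 0.

Lemma two_F : (2 : K) != 0.
Proof. by rewrite -(natF 2) tofrac_eq0 polyC_eq0. Qed.

Lemma tofrac_half : (2^-1)%:P%:F = 2^-1 :> K.
Proof.
by apply: (mulfI two_F); rewrite divff ?two_F // -(natF 2) -tofracM -polyCM divff.
Qed.

Lemma tofrac_sqr_quarter (c : k) : (c ^+ 2 / 4)%:P%:F = c%:P%:F ^+ 2 / 4.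
Proof.
rewrite -half_sq // polyC_exp tofracXn polyCM tofracM tofrac_half.
by rewrite half_sq // two_F.
Qed.

Variables q E1 : {poly k}.
Hypothesis qE : q * (q \Po (- 'X - 1)) = (Dq_rho q ^+ 2 / 4)%:P
  + ('X + (2^-1)%:P) ^+ 2 * (E1 \Po ('X + (2^-1)%:P) ^+ 2).

Local Notation u := (Dq_u k).
Local Notation v := (Dq_v q).
Local Notation w := (Dq_w q).
Local Notation h := (Dq_h k).
Let rF : K := ((Dq_rho q)%:P)%:F.
Let X1 : K := (E1 \Po ('X + (2^-1)%:P) ^+ 2)%:F.
Let X1' : K := (E1 \Po ('X - (2^-1)%:P) ^+ 2)%:F.

Lemma shift_rho_term j : fshift j (rho_term rF h) = rho_term rF (fshift j h).
Proof.
rewrite /rho_term !(rmorphM, fmorphV, rmorphB, rmorphXn, rmorph1, rmorph_nat) /=.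
by rewrite shiftC.
Qed.

Lemma shift_split_s j :
  fshift j (split_s rF h X1) = split_s rF (fshift j h) (fshift j X1).
Proof.
rewrite /split_s !(rmorphM, fmorphV, rmorphD, rmorphXn, rmorph1, rmorph_nat) /=.
by rewrite shiftC.
Qed.

Lemma shift_X1 : fshift (-1) X1 = X1'.
Proof.
rewrite fshift_tofrac /pshift -comp_polyA !rmorphXn rmorphD /= comp_polyX comp_polyC.
congr (_ \Po _ ^+ 2)%:F; rewrite -addrA -polyCD -polyCN; congr (_ + _%:P).
by field.
Qed.

Lemma Dq_sE : Dq_s q = split_s rF h X1.
Proof.
rewrite /Dq_s qE /split_s; congr (_ / _).
by rewrite tofracD tofracM tofracXn tofracD tofrac_sqr_quarter tofrac_half.
Qed.

Lemma Dq_vE : v = skew3 1 (2 * rho_term rF h) (fshift (-1) (split_s rF h X1)).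
Proof. by rewrite Dq_v_skew3 Dq_sE. Qed.

Lemma Dq_wE : w = skew3 h (- rho_term rF h) (- fshift (-1) (split_s rF h X1) * h).
Proof. by rewrite Dq_w_skew3 Dq_sE. Qed.

Variables G H : {poly k}.
Hypothesis GE : (2 : {poly k}) * 'X * (G \Po 'X^2) =
  (E1 \Po ('X + (2^-1)%:P) ^+ 2) - (E1 \Po ('X - (2^-1)%:P) ^+ 2).
Hypothesis HE : (2 : {poly k}) * (H \Po 'X^2) =
  (E1 \Po ('X + (2^-1)%:P) ^+ 2) + (E1 \Po ('X - (2^-1)%:P) ^+ 2).

Let h0 : h != 0.
Proof. by rewrite tofrac_eq0 polyX_eq0. Qed.

Lemma divf_eqP (L : fieldType) (x y z : L) : y != 0 -> y * x = z -> x = z / y.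
Proof. by move=> y0 <-; rewrite mulrC mulKf. Qed.

Lemma G_F : (G \Po 'X^2)%:F = (X1 - X1') / (2 * h).
Proof.
apply: divf_eqP; first by apply: mulf_neq0; [exact: two_F|exact: h0].
rewrite -(natF 2) polyC_natr /Dq_h -tofracM -tofracM GE; exact: tofracB.
Qed.

Lemma H_F : (H \Po 'X^2)%:F = (X1 + X1') / 2.
Proof.
apply: divf_eqP; first exact: two_F.
rewrite -(natF 2) polyC_natr -tofracM HE; exact: tofracD.
Qed.

Let hp : h + 1 != 0.
Proof.
have := tofrac_linear_neq0 1 (oner_neq0 k).
by rewrite polyC1 tofrac1 mul1r addrC.
Qed.

Let hm : h - 1 != 0.
Proof.
have := tofrac_linear_neq0 (-1) (oner_neq0 k).
by rewrite polyCN tofracN polyC1 tofrac1 mul1r addrC.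
Qed.

Let p1 : 1 + 2 * h != 0.
Proof. by have := tofrac_linear_neq0 1 two; rewrite (natF 2) (natF 1). Qed.

Let p3 : 3 + 2 * h != 0.
Proof. by have := tofrac_linear_neq0 3 two; rewrite (natF 2) (natF 3). Qed.

Let two' : (- 2 : k) != 0. Proof. by rewrite oppr_eq0. Qed.

Let m1 : 1 - 2 * h != 0.
Proof.
by have := tofrac_linear_neq0 1 two'; rewrite polyCN tofracN (natF 2) (natF 1) mulNr.
Qed.

Let m3 : 3 - 2 * h != 0.
Proof.
by have := tofrac_linear_neq0 3 two'; rewrite polyCN tofracN (natF 2) (natF 3) mulNr.
Qed.

Lemma shift_split_s_back : fshift (-1) (split_s rF h X1) = split_s rF (h - 1) X1'.
Proof. by rewrite shift_split_s shiftm1h shift_X1. Qed.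

Lemma shift_split_s_forth : fshift 1 (split_s rF (h - 1) X1') = split_s rF h X1.
Proof. by rewrite -shift_split_s_back fshift_comp fshift0. Qed.

Lemma shift_rho_term_h :
  (fshift 1 (rho_term rF h) = rho_term rF (h + 1)) *
  (fshift (-1) (rho_term rF h) = rho_term rF (h - 1)).
Proof. by rewrite !shift_rho_term shift1h shiftm1h. Qed.

Lemma Dq_commutator_uv : u * v - v * u = 2 *: w + v.
Proof.
rewrite scale_skew natF Dq_vE Dq_wE shift_split_s_back.
exact (skew3_uv rF X1' (shift1h, shiftm1h)).
Qed.

Lemma Dq_commutator_uw : u * w - w * u = 2 *: (v * u) + w + (Dq_rho q)%:A.
Proof.
rewrite (scale_skew 2) (scale_skew (Dq_rho q)) mulr1 natF Dq_vE Dq_wE shift_split_s_back.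
exact (skew3_uw rF X1' p1 m1 (shift1h, shiftm1h)).
Qed.

Lemma Dq_commutator_vw :
  v * w - w * v = - (v * v) + smono 0 (G \Po 'X^2)%:F.
Proof.
rewrite G_F Dq_vE Dq_wE shift_split_s_back.
exact (skew3_vw two_F h0 hp hm p1 m1 p3 m3 (shift1h, shiftm1h)
  shift_split_s_forth shift_rho_term_h).
Qed.

Lemma Dq_relation :
  w * w - v * (u * v) + v * w + v * v - Dq_rho q *: v
  + smono 0 (H \Po 'X^2)%:F = 0.
Proof.
rewrite H_F scale_skew -/rF Dq_vE Dq_wE shift_split_s_back.
exact (skew3_ww two_F h0 hp hm p1 m1 p3 m3 (shift1h, shiftm1h)
  shift_split_s_forth shift_rho_term_h (shiftC (Dq_rho q))).
Qed.

End Skew.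

(** * Leading terms and independence of the normal monomials *)

Section LeadingTerm.
Variable k : fieldType.
Local Notation K := {fraction {poly k}}.
Local Notation "p %:F" := (@FracField.tofrac {poly k} p).
Local Notation smono := (@SkewAlgebra.skew_mono k).
Local Notation coef := (@SkewAlgebra.skew_coef k).
Implicit Types (x : SkewAlgebra.skew k) (J D : nat).

Lemma skew_coefD x y l : coef (x + y) l = coef x l + coef y l.
Proof. exact: monalg.mcoeffD. Qed.

Lemma skew_coef_mono i f l : coef (smono i f) l = f *+ (i == l).
Proof. exact: monalg.mcoeffU. Qed.

Lemma skew_coef0 l : coef 0 l = 0.
Proof. exact: monalg.mcoeff0. Qed.

Lemma shift_zero j : fshift j (0 : K) = 0.
Proof. exact: raddf0. Qed.

Lemma skew_coefMmono x j f l : coef (x * smono j f) l = fshift j (coef x (l - j)) * f.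
Proof.
elim/SkewAlgebra.skew_ind: x => [|x y IHx IHy|i g].
- by rewrite mul0r !skew_coef0 shift_zero mul0r.
- by rewrite mulrDl !skew_coefD IHx IHy rmorphD mulrDl.
- rewrite SkewAlgebra.skew_mono_mul !skew_coef_mono [i == _]eq_sym subr_eq eq_sym.
  by case: eqP => _; rewrite ?mulr1n // !mulr0n shift_zero mul0r.
Qed.

Lemma skew_coefZ a x l : coef (a *: x) l = coef x l * a%:P%:F.
Proof.
rewrite scale_skew -SkewAlgebra.skew_constC skew_coefMmono fshift0.
by rewrite subr0.
Qed.

Lemma skew_coefM3 x (x1 x0 xm : K) l : coef (x * skew3 x1 x0 xm) l =
  fshift 1 (coef x (l - 1)) * x1 + coef x l * x0
  + fshift (-1) (coef x (l + 1)) * xm.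
Proof.
by rewrite skew3.unlock !mulrDr !skew_coefD !skew_coefMmono fshift0 subr0 opprK.
Qed.

(** The highest power of a in x is a^J, and its coefficient is a polynomial of
    degree D. *)
Definition leading x J D :=
  (forall l : int, J%:Z < l -> coef x l = 0) /\
  exists2 p : {poly k}, size p = D.+1 & coef x J%:Z = p%:F.

Lemma leading1 : leading 1 0 0.
Proof.
split=> [l l0|]; first by rewrite skew_coef_mono lt_eqF.
by exists 1; rewrite ?size_poly1 // skew_coef_mono tofrac1.
Qed.

Lemma leadingZ a x J D : a != 0 -> leading x J D -> leading (a *: x) J D.
Proof.
move=> a0 [x0 [p sp xp]]; split=> [l /x0 xl|].
  by rewrite skew_coefZ xl mul0r.
exists (a *: p); first by rewrite size_scale.
by rewrite skew_coefZ xp -tofracM mulrC mul_polyC.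
Qed.

Lemma leadingM0 x J D (p : {poly k}) e : leading x J D -> size p = e.+1 ->
  leading (x * smono 0 p%:F) J (D + e).
Proof.
move=> [x0 [p' sp xp]] se; split=> [l /x0 xl|].
  by rewrite skew_coefMmono subr0 xl shift_zero mul0r.
exists (p' * p); last by rewrite skew_coefMmono subr0 fshift0 xp tofracM.
by rewrite size_mul -?size_poly_eq0 ?sp ?se // addnS.
Qed.

Lemma leadingM3 x J D (p : {poly k}) e (y z : K) : leading x J D -> size p = e.+1 ->
  leading (x * skew3 p%:F y z) J.+1 (D + e).
Proof.
move=> [x0 [p' sp xp]] se; split=> [l lJ|].
  by rewrite skew_coefM3 !x0 ?shift_zero ?mul0r ?addr0 //; lia.
exists (pshift 1 p' * p).
  rewrite size_mul -?size_poly_eq0 /pshift ?size_comp_poly2 ?size_XaddC ?sp ?se //.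
  by rewrite addnS.
rewrite skew_coefM3 [X in _ + X * y]x0 ?[X in _ + fshift _ X * z]x0; [|lia..].
rewrite shift_zero !mul0r !addr0 (_ : J.+1%:Z - 1 = J); last lia.
by rewrite xp fshift_tofrac tofracM.
Qed.

Lemma leadingX x y J D dJ dD m :
  (forall x J D, leading x J D -> leading (x * y) (J + dJ) (D + dD)) ->
  leading x J D -> leading (x * y ^+ m) (J + m * dJ) (D + m * dD).
Proof.
move=> xy xJ; elim: m => [|m IH]; first by rewrite mulr1 !addn0.
by rewrite exprSr mulrA !mulSnr !addnA; apply: xy.
Qed.

End LeadingTerm.

Notation ord3_0 := (@Ordinal 3 0 isT).
Notation ord3_1 := (@Ordinal 3 1 isT).
Notation ord3_2 := (@Ordinal 3 2 isT).

Lemma ord3_ind (P : 'I_3 -> Prop) : P ord3_0 -> P ord3_1 -> P ord3_2 -> forall i, P i.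
Proof.
move=> P0 P1 P2 [[|[|[|//]]] lti].
- by rewrite (_ : Ordinal lti = ord3_0) //; apply: val_inj.
- by rewrite (_ : Ordinal lti = ord3_1) //; apply: val_inj.
- by rewrite (_ : Ordinal lti = ord3_2) //; apply: val_inj.
Qed.

Lemma seq_argmax (T : eqType) (s : seq T) (f : T -> nat) x0 : x0 \in s ->
  exists2 x, x \in s & forall y, y \in s -> (f y <= f x)%N.
Proof.
elim: s x0 => // a s IH x0 _; case: s IH => [_|b s IH].
  by exists a; rewrite ?mem_head // => y; rewrite inE => /eqP->.
have [x xs xmax] := IH b (mem_head _ _).
have [fxa|fax] := leqP (f x) (f a).
  exists a; rewrite ?mem_head // => y; rewrite inE => /orP[/eqP-> //|/xmax yx].
  exact: leq_trans yx fxa.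
exists x; first by rewrite inE xs orbT.
by move=> y; rewrite inE => /orP[/eqP->|/xmax //]; apply: ltnW.
Qed.

Section Independence.
Variables (k : fieldType) (q : {poly k}) (c : 'I_3 -> k).
Hypothesis c0 : forall i, c i != 0.
Local Notation A := (gen_alg (Dq_gen q)).

Definition w_exponent_le1 : pred 'X_{1..3} := fun m => (m ord3_2 <= 1)%N.

Lemma leading_Dq i x J D : leading x J D ->
  leading (x * (c i *: Dq_gen q i)) (J + (0 < i)) (D + nth 0 [:: 2; 0; 1] i)%N.
Proof.
move=> xJ; rewrite -scalerAr; apply: leadingZ => //.
elim/ord3_ind: i => /=; rewrite ?addn0 ?addn1.
- rewrite [Dq_gen _ _]/(Dq_u k) /Dq_u /Dq_h -tofracXn.
  by apply: leadingM0; rewrite ?size_polyXn.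
- rewrite (_ : Dq_gen q ord3_1 = Dq_v q) // Dq_v_skew3 -tofrac1 -[D]addn0.
  by apply: leadingM3; rewrite ?size_poly1.
- rewrite (_ : Dq_gen q ord3_2 = Dq_w q) // Dq_w_skew3 /Dq_h -[D.+1]addn1.
  by apply: leadingM3; rewrite ?size_polyX.
Qed.

Lemma leading_monomial (m : 'X_{1..3}) :
  leading (val (mmap1 (fun i => c i *: gen (Dq_gen q) i) m))
    (m ord3_1 + m ord3_2) (2 * m ord3_0 + m ord3_2).
Proof.
rewrite /mmap1 !big_ord_recl big_ord0 mulr1 !rmorphM !rmorphXn /=.
rewrite (_ : lift _ (lift _ _) = ord3_2); last exact: val_inj.
rewrite (_ : lift _ _ = ord3_1); last exact: val_inj.
rewrite (_ : ord0 = ord3_0); last exact: val_inj.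
have := leadingX (m ord3_0) (@leading_Dq ord3_0) (leading1 k).
move/(leadingX (m ord3_1) (@leading_Dq ord3_1)).
move/(leadingX (m ord3_2) (@leading_Dq ord3_2)).
by rewrite mul1r -mulrA /= !(muln0, muln1, addn0, add0n) [(2 * _)%N]mulnC.
Qed.

Lemma skew_coef_sum (I : Type) (s : seq I) (F : I -> SkewAlgebra.skew k) l :
  SkewAlgebra.skew_coef (\sum_(i <- s) F i) l =
  \sum_(i <- s) SkewAlgebra.skew_coef (F i) l.
Proof.
elim: s => [|a s IH]; first by rewrite !big_nil; apply: skew_coef0.
by rewrite !big_cons skew_coefD IH.
Qed.

(** Among the monomials of p with the largest power of a, take one whose
    coefficient has the largest degree in h.  Different normal monomials with
    the same power of a have different degrees, so its top term survives. *)
Lemma normal_monomials_free (p : {mpoly k[3]}) :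
  normal_poly w_exponent_le1 p -> ordered_eval (Dq_gen q) c p = 0 -> p = 0.
Proof.
move=> Np p0; apply/eqP/negPn/negP => pn0.
have Nm m : m \in msupp p -> (m ord3_2 <= 1)%N.
  by rewrite mcoeff_msupp; apply: contraNT => /Np ->.
pose Jm (m : 'X_{1..3}) := (m ord3_1 + m ord3_2)%N.
pose Dm (m : 'X_{1..3}) := (2 * m ord3_0 + m ord3_2)%N.
have [m1 m1p m1max] := seq_argmax Jm (mlead_supp pn0).
have m1f : m1 \in [seq m <- msupp p | Jm m == Jm m1].
  by rewrite mem_filter eqxx.
have [m0 m0f m0max] := seq_argmax Dm m1f.
move: m0f; rewrite mem_filter => /andP[/eqP Jm0 m0p].
have Pex m : exists P : {poly k}, size P = (Dm m).+1 /\
    SkewAlgebra.skew_coef (val (mmap1 (fun i => c i *: gen (Dq_gen q) i) m))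
      (Jm m)%:Z = FracField.tofrac P.
  by have [_ [P sP PE]] := leading_monomial m; exists P.
have [P PE] := boolp.choice Pex.
pose S := \sum_(m <- msupp p | Jm m == Jm m1) p@_m *: P m.
have S0 : S = 0.
  apply/eqP; rewrite -tofrac_eq0; apply/eqP.
  have := congr1 (fun x => SkewAlgebra.skew_coef (val x) (Jm m1)%:Z) p0.
  rewrite /= skew_coef0 => <-.
  rewrite /ordered_eval /mmap /S raddf_sum /= -[gen_val _]/(val _).
  rewrite (raddf_sum val) skew_coef_sum.
  rewrite big_mkcond /= big_seq [RHS]big_seq; apply: eq_bigr => m mp.
  rewrite mulr_algl /= skew_coefZ.
  have [Jmm|Jmm] := eqVneq (Jm m) (Jm m1).
    by rewrite -Jmm (PE m).2 -mul_polyC tofracM mulrC.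
  rewrite (leading_monomial m).1; first by rewrite mul0r.
  by rewrite ltz_nat ltn_neqAle Jmm m1max.
have : S`_(Dm m0) = p@_m0 * (P m0)`_(Dm m0).
  rewrite /S coef_sum big_mkcond (bigD1_seq m0) ?msupp_uniq //= Jm0 eqxx coefZ.
  rewrite big_seq_cond big1 ?addr0 // => m /andP[mp mm0]; case: eqP => // Jmm.
  have Dmm : (Dm m <= Dm m0)%N by apply: m0max; rewrite mem_filter Jmm eqxx.
  rewrite coefZ [(P m)`__]nth_default ?mulr0 // (PE m).1 ltn_neqAle Dmm andbT.
  apply: contraNneq mm0 => DD; apply/eqP/mnmP.
  move: (Nm _ mp) (Nm _ m0p) Jmm Jm0 DD; rewrite /Jm /Dm => h1 h2 h3 h4 h5.
  by elim/ord3_ind; lia.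
rewrite S0 coef0 => /esym/eqP; rewrite mulf_eq0 mcoeff_eq0 m0p /=.
rewrite -[Dm m0]/((Dm m0).+1.-1) -(PE m0).1 -/(lead_coef _) lead_coef_eq0.
by rewrite -size_poly_eq0 (PE m0).1.
Qed.

End Independence.

(** * Normal forms modulo the equation of D_n *)

Section NormalForms.
Variables (k : fieldType) (n : nat).
Hypothesis n_ge2 : (2 <= n)%N.
Local Notation wt := (Dn_weight n).

Lemma Dn_weightU i : Dn_weight n U_(i)%MM = Dn_deg n i.
Proof.
rewrite /Dn_weight (bigD1 i) //= mnm1E eqxx mul1n big1 ?addn0 // => j ji.
by rewrite mnm1E eq_sym (negbTE ji).
Qed.

Lemma Dn_weightE m :
  wt m = (m ord3_0 * 4 + m ord3_1 * (2 * n - 4) + m ord3_2 * (2 * n - 2))%N.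
Proof.
rewrite /Dn_weight !big_ord_recl big_ord0 addn0 addnA.
rewrite (_ : lift _ (lift _ _) = ord3_2); last exact: val_inj.
rewrite (_ : lift _ _ = ord3_1); last exact: val_inj.
by rewrite (_ : ord0 = ord3_0); last exact: val_inj.
Qed.

(** The equation rewrites w^2 as u v^2 - (-1)^n u^(n-1), preserving the weight
    and lowering the exponent of w. *)
Lemma Dn_normal_form (m : 'X_{1..3}) : exists p : {mpoly k[3]},
  [/\ p \is (wt m).-homog for wt, normal_poly w_exponent_le1 p &
      'X_[m] - p \in ideal2_pred (Dn_ideal k n)].
Proof.
have [e] := ubnP (m ord3_2); elim: e m => // e IH m; rewrite ltnS => me.
have [m1|m2] := leqP (m ord3_2) 1.
  exists 'X_[m]; split; first by rewrite dhomogX.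
    move=> u; rewrite mcoeffX; case: eqP => // <-.
    by rewrite /w_exponent_le1 m1.
  by rewrite subrr rpred0.
pose nu := (m - U_(ord3_2) *+ 2)%MM.
have mE : m = (nu + U_(ord3_2) *+ 2)%MM.
  apply/mnmP => i; rewrite mnmDE mnmBE mulmnE mnm1E.
  by elim/ord3_ind: i => /=; lia.
have mnmE3 := (@mnmDE 3, @mulmnE 3, @mnm1E 3).
(* The monomials obtained from 'X_[m] by replacing w^2 with u v^2 and with
   u^(n-1). *)
pose a := (nu + U_(ord3_0) + U_(ord3_1) *+ 2)%MM.
pose b := (nu + U_(ord3_0) *+ n.-1)%MM.
have nu2 : nu ord3_2 = (m ord3_2 - 2)%N by rewrite mnmBE mulmnE mnm1E.
have a2 : (a ord3_2 < e)%N by rewrite /a !mnmE3 nu2 /=; lia.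
have b2 : (b ord3_2 < e)%N by rewrite /b !mnmE3 nu2 /=; lia.
have wa : wt a = wt m.
  rewrite /a [in RHS]mE !Dn_weightE !mnmE3 /=; lia.
have wb : wt b = wt m.
  rewrite /b [in RHS]mE !Dn_weightE !mnmE3 /=; lia.
have [pa [pah pan paI]] := IH a a2; have [pb [pbh pbn pbI]] := IH b b2.
exists (pa - (-1) ^+ n *: pb); split.
- by rewrite -wa rpredB // dhomogZ // wa -wb.
- by move=> u Nu; rewrite mcoeffB mcoeffZ pan // pbn // mulr0 subr0.
have -> : 'X_[m] - (pa - (-1) ^+ n *: pb) =
    'X_[nu] * Dn_eqn k n + (('X_[a] - pa) - (-1) ^+ n *: ('X_[b] - pb)).
  rewrite /Dn_eqn /a /b [in LHS]mE !mpolyXD -!mpolyXn -mul_mpolyC !scalerBr.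
  by rewrite -!mul_mpolyC !rmorphXn rmorphN1; ring.
apply: rpredD; last first.
  by apply: rpredB => //; rewrite -mul_mpolyC; apply: ideal2_mull.
by apply/Dn_ideal_predP; exists 'X_[nu].
Qed.

End NormalForms.

(** * Degrees of the relations in D(q) *)

Section Deformation.
Variables (k : fieldType) (q : {poly k}) (n : nat).
Hypotheses (two : (2 : k) != 0) (n_ge4 : (4 <= n)%N) (size_q : size q = n.+1).

Local Notation A := (gen_alg (Dq_gen q)).
Local Notation Fl := (Dq_filtration q n).
Local Notation U := (gen (Dq_gen q) ord3_0 : A).
Local Notation V := (gen (Dq_gen q) ord3_1 : A).
Local Notation W := (gen (Dq_gen q) ord3_2 : A).

Lemma val_horner_alg (p : {poly k}) : gen_val (horner_alg U p) =
  SkewAlgebra.skew_mono 0 (FracField.tofrac (p \Po 'X^2)).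
Proof.
elim/poly_ind: p => [|p c IH].
  by rewrite rmorph0 comp_poly0 tofrac0 !raddf0.
rewrite rmorphD rmorphM /= horner_algX horner_algC.
transitivity (gen_val (horner_alg U p) * Dq_u k + c *: 1); first by [].
rewrite comp_polyD comp_polyM comp_polyX comp_polyC tofracD tofracM raddfD /=.
rewrite IH scale_skew mulr1; congr (_ + _).
by rewrite SkewAlgebra.skew_mono_mul addr0 fshift0 tofracXn.
Qed.

Lemma fil_prev_lt m m' x : x \in fil Fl m' -> (m' < m)%N -> x \in fil_prev Fl m.
Proof. by case: m => // m xF lt; apply: word_fil_le xF. Qed.

Lemma fil_leq m m' x : x \in fil Fl m' -> (m' <= m)%N -> x \in fil Fl m.
Proof. by move=> xF le; apply: word_fil_le xF. Qed.

Let UF : U \in fil Fl 4 := gen_fil (Dq_gen q) (Dn_deg n) ord3_0.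
Let VF : V \in fil Fl (2 * n - 4) := gen_fil (Dq_gen q) (Dn_deg n) ord3_1.
Let WF : W \in fil Fl (2 * n - 2) := gen_fil (Dq_gen q) (Dn_deg n) ord3_2.

Lemma horner_alg_fil (p : {poly k}) m : (size p <= m.+1)%N ->
  horner_alg U p \in fil Fl (4 * m).
Proof.
move=> sp; rewrite -[p]coefK poly_def linear_sum; apply: rpred_sum => i _.
rewrite linearZ /= rmorphXn /= horner_algX mulr_algl; apply: (filZ (Fl := Fl)).
apply: (@fil_leq _ (i * 4)); last by have := ltn_ord i; lia.
elim: (i : nat) => [|j IH]; first exact: fil_one.
by rewrite exprS mulSn; apply: fil_mul.
Qed.

(** E1 is E with its constant term rho^2/4 removed, divided by X. *)
Lemma Dq_structure : exists G H : {poly k}, [/\ (size G <= n.-1)%N,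
  size H = n /\ H`_n.-1 = (-1) ^+ n * lead_coef q ^+ 2 &
  [/\ U * V - V * U = 2 *: W + V,
   U * W - W * U = 2 *: (V * U) + W + (Dq_rho q)%:A,
   V * W - W * V = - (V * V) + horner_alg U G &
   W * W - V * (U * V) + V * W + V * V - Dq_rho q *: V + horner_alg U H = 0]].
Proof.
have [E [qE E0 /(_ _ size_q)[szE En]]] := reflected_product two q.
pose E1 := drop_poly 1 E.
have szE1 : size E1 = n.-1.+1.
  by rewrite size_drop_poly szE subn1; lia.
have EE : E = ((Dq_rho q) ^+ 2 / 4)%:P + 'X * E1.
  rewrite -{1}[E](poly_take_drop 1) [_ * 'X^1]mulrC expr1; congr (_ + _).
  apply/polyP => i; rewrite coef_take_poly coefC; case: i => [|i] //=.
  by rewrite E0 /Dq_rho -half_sq // [_ / 2]mulrC mulKf.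
have E1n : E1`_n.-1 = (-1) ^+ n * lead_coef q ^+ 2.
  by rewrite coef_drop_poly addn1 prednK ?En //; lia.
have qE1 : q * (q \Po (- 'X - 1)) = ((Dq_rho q) ^+ 2 / 4)%:P
    + ('X + (2^-1)%:P) ^+ 2 * (E1 \Po ('X + (2^-1)%:P) ^+ 2).
  by rewrite qE {1}EE comp_polyD comp_polyM comp_polyX comp_polyC.
have [G szG GE] := difference_quotient two szE1.
have [H [szH Hn HE]] := symmetric_sum two szE1.
exists G, H; split=> //.
  by rewrite szH Hn E1n prednK //; lia.
split; apply: val_inj.
- exact: (@Dq_commutator_uv _ two q E1 qE1).
- exact: (@Dq_commutator_uw _ two q E1 qE1).
- transitivity (- (Dq_v q * Dq_v q) + gen_val (horner_alg U G)); last by [].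
  rewrite val_horner_alg; exact: (@Dq_commutator_vw _ two q E1 qE1 G GE).
- transitivity (Dq_w q * Dq_w q - Dq_v q * (Dq_u k * Dq_v q)
    + Dq_v q * Dq_w q + Dq_v q * Dq_v q - Dq_rho q *: Dq_v q
    + gen_val (horner_alg U H)); first by [].
  rewrite val_horner_alg; exact: (@Dq_relation _ two q E1 qE1 H HE).
Qed.

Lemma Dq_gen_commutator i j :
  gen (Dq_gen q) i * gen (Dq_gen q) j - gen (Dq_gen q) j * gen (Dq_gen q) i
    \in fil_prev Fl (Dn_deg n i + Dn_deg n j).
Proof.
have [G [_ [szG _ [uv uw vw _]]]] := Dq_structure.
have uvF : U * V - V * U \in fil_prev Fl (4 + (2 * n - 4)).
  apply: (@fil_prev_lt _ (2 * n - 2)); last lia.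
  by rewrite uv rpredD ?(filZ (Fl := Fl)) //; apply: fil_leq VF _; lia.
have uwF : U * W - W * U \in fil_prev Fl (4 + (2 * n - 2)).
  apply: (@fil_prev_lt _ (2 * n)); last lia.
  rewrite uw !rpredD ?(filZ (Fl := Fl)) //.
  - by apply: fil_leq (fil_mul VF UF) _; lia.
  - by apply: fil_leq WF _; lia.
  - by apply: fil_leq (fil_one Fl) _; lia.
have vwF : V * W - W * V \in fil_prev Fl (2 * n - 4 + (2 * n - 2)).
  apply: (@fil_prev_lt _ (4 * n - 8)); last lia.
  rewrite vw rpredD ?rpredN //.
    by apply: fil_leq (fil_mul VF VF) _; lia.
  by apply: fil_leq (horner_alg_fil (m := n - 2) _) _; lia.
have sym x y m : x - y \in fil_prev Fl m -> y - x \in fil_prev Fl m.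
  by rewrite -opprB rpredN.
by elim/ord3_ind: i; elim/ord3_ind: j;
  rewrite ?subrr ?rpred0 //; rewrite addnC; apply: sym.
Qed.

(** With c the leading coefficient of q, dividing the relation
    (-1)^n c^2 u^(n-1) - u v^2 + w^2 = 0 by c^2 gives the equation of D_n for
    u, v/c and w/c. *)
Definition Dq_scaling (i : 'I_3) : k :=
  if i == ord3_0 then 1 else (lead_coef q)^-1.

Let lead_neq0 : lead_coef q != 0.
Proof. by rewrite lead_coef_eq0 -size_poly_eq0 size_q. Qed.

Lemma Dq_scaling_neq0 i : Dq_scaling i != 0.
Proof. by rewrite /Dq_scaling; case: ifP => _; rewrite ?oner_neq0 ?invr_neq0. Qed.

Local Notation ev := (ordered_eval (Dq_gen q) Dq_scaling).

Lemma ordered_eval_monomial (m : 'X_{1..3}) : ev 'X_[m] =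
  U ^+ m ord3_0 * (((lead_coef q)^-1 *: V) ^+ m ord3_1 *
    ((lead_coef q)^-1 *: W) ^+ m ord3_2).
Proof.
rewrite /ordered_eval mmapX /mmap1 !big_ord_recl big_ord0 mulr1.
rewrite (_ : lift _ (lift _ _) = ord3_2); last exact: val_inj.
rewrite (_ : lift _ _ = ord3_1); last exact: val_inj.
rewrite (_ : ord0 = ord3_0); last exact: val_inj.
by rewrite /Dq_scaling /= scale1r.
Qed.

(** Eliminating w^2 by the exact relation leaves vuv - uv^2 = - [u,v] v and
    terms of visibly smaller degree, since the top terms in u cancel. *)
Lemma Dq_relation_fil :
  ((-1) ^+ n * lead_coef q ^+ 2) *: U ^+ n.-1 - U * (V * V) + W * W
    \in fil Fl (4 * n - 6).
Proof.
have [G [H [_ [szH Hn] [uv _ _]]]] := Dq_structure.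
move/eqP; rewrite addr_eq0 => /eqP /(canRL (subrK _)) /(canRL (addrK _)).
move=> /(canRL (addrK _)) /(canRL (subrK _)) ->; rewrite -Hn.
rewrite (_ : _ + _ = (H`_n.-1 *: U ^+ n.-1 - horner_alg U H) +
    (V * (U * V) - U * (V * V)) + (Dq_rho q *: V - V * V - V * W)); last first.
  by rewrite [LHS](AC (2*5) ((1*3)*(7*2)*(4*5*6))).
apply: rpredD; first apply: rpredD.
- have -> : H`_n.-1 *: U ^+ n.-1 - horner_alg U H =
      horner_alg U (H`_n.-1 *: 'X^(n.-1) - H).
    by rewrite raddfB /= linearZ /= rmorphXn /= horner_algX mulr_algl.
  apply: fil_leq (horner_alg_fil (m := n - 2) _) _; last lia.
  apply/leq_sizeP => i lei; rewrite coefB coefZ coefXn.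
  case: eqP => [->|ni]; first by rewrite mulr1 subrr.
  by rewrite mulr0 sub0r nth_default ?oppr0 // szH; lia.
- rewrite !mulrA -mulrBl -opprB uv mulNr rpredN.
  apply: fil_leq (fil_mul (i := 2 * n - 2) _ VF) _; last lia.
  by rewrite rpredD ?(filZ (Fl := Fl)) //; apply: fil_leq VF _; lia.
- rewrite !rpredB ?(filZ (Fl := Fl)) //.
  + by apply: fil_leq VF _; lia.
  + by apply: fil_leq (fil_mul VF VF) _; lia.
  + by apply: fil_leq (fil_mul VF WF) _; lia.
Qed.

Lemma Dn_eqnE : Dn_eqn k n = (-1) ^+ n *: 'X_[U_(ord3_0) *+ n.-1] -
  'X_[U_(ord3_0) + U_(ord3_1) *+ 2] + 'X_[U_(ord3_2) *+ 2].
Proof.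
rewrite mpolyXD -!mpolyXn -mul_mpolyC rmorphXn rmorphN1; exact: erefl.
Qed.

Lemma Dn_eqn_homog : Dn_eqn k n \is (4 * n - 4).-homog for (Dn_weight n).
Proof.
rewrite Dn_eqnE; apply: rpredD; first apply: rpredB.
- apply: dhomogZ; rewrite dhomogX /= Dn_weightE !mulmnE !mnm1E /=; lia.
- rewrite dhomogX /= Dn_weightE !(mnmDE, mulmnE, mnm1E) /=; lia.
- rewrite dhomogX /= Dn_weightE !mulmnE !mnm1E /=; lia.
Qed.

Lemma ordered_eval_Dn_eqn : ev (Dn_eqn k n) \in fil_prev Fl (4 * n - 4).
Proof.
apply: (@fil_prev_lt _ (4 * n - 6)); last lia.
have -> : ev (Dn_eqn k n) = lead_coef q ^- 2 *:
   (((-1) ^+ n * lead_coef q ^+ 2) *: U ^+ n.-1 - U * (V * V) + W * W).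
  rewrite Dn_eqnE raddfD raddfB /= linearZ /= !ordered_eval_monomial.
  rewrite !(mnmDE, mulmnE, mnm1E) /= !(mul0n, mul1n, expr0, expr1, mulr1, mul1r).
  rewrite scalerDr scalerBr scalerA mulrC mulfK ?expf_neq0 //.
  by rewrite !expr2 -!(scalerAl, scalerAr) !scalerA -invfM.
exact/filZ/Dq_relation_fil.
Qed.

Lemma gr_eval_Dn_eqn : gr_eval (Dq_gen q) (Dn_deg n) Dq_scaling (Dn_eqn k n) = 0.
Proof.
have [eF ->] :=
  symbol_ordered_eval (Dq_gen q) Dq_scaling (Dn_weightU n) Dn_eqn_homog.
by apply/gr_class_eq0/ordered_eval_Dn_eqn.
Qed.

Theorem Dq_deformation : is_deformation Fl (@Dn_coord_deg k n).
Proof.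
apply: (@deformation_of_presentation k _ 3 (Dq_gen q) (Dn_weight n) (Dn_deg n)
  Dq_scaling (Dn_weightU n) Dq_scaling_neq0 Dq_gen_commutator (Dn_ideal k n) _
  w_exponent_le1).
- move=> p /Dn_ideal_predP[p' ->].
  have [_ ->] := gr_eval_monoid Dq_scaling Dq_gen_commutator.
  by rewrite gr_eval_Dn_eqn mulr0.
- by move=> m; apply: Dn_normal_form; lia.
- exact: normal_monomials_free Dq_scaling_neq0.
Qed.

End Deformation.

Theorem theorem4p5 (R : realType) (n : nat) (q : {poly R[i]}) :
  (4 <= n)%N -> size q = n.+1 ->
  is_deformation (Dq_filtration q n) (@Dn_coord_deg R[i] n).
Proof.
apply: Dq_deformation.
by rewrite pnatr_eq0.
Qed.
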